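(* If $\det\nabla F_T\in\mathbb{P}_1(\widehat T)$ for all $T\in\mathcal{T}_h$ with $p_T\ge2$, then $\Lambda^{(s)}_{hp}=\Lambda^{(w)}_{hp}$, where $$\Lambda^{(s)}_{hp}:=\{\mu_{hp}\in Q_{hp}: |\mu_{hp}(F_T(\hat x_{k,T}))|_F\le\sigma_y\ \text{for all }1\le k\le n_T\text{ and }T\in\mathcal{T}_h\},$$ $$\Lambda^{(w)}_{hp}:=\{\mu_{hp}\in Q_{hp}: (\mu_{hp},q_{hp})_{0,\Omega}\le\psi_{hp}(q_{hp})\ \text{for all } q_{hp}\in Q_{hp}\}.$$
   Context: Let $d\in\{2,3\}$ and $\Omega\subset\mathbb{R}^d$ a bounded Lipschitz domain. $\mathbb{S}_{d,0}$ is the space of symmetric real $d\times d$ matrices with vanishing trace, $|\cdot|_F$ the Frobenius norm, $Q:=L^2(\Omega,\mathbb{S}_{d,0})$ with inner product $(p,q)_{0,\Omega}=\int_\Omega p:q\,dx$ ($:$ the Frobenius inner product). $\sigma_y>0$ is a constant. $\mathcal{T}_h$ is a locally quasi-uniform finite element mesh of $\Omega$ of convex, shape regular quadrilaterals ($d=2$) or hexahedrons ($d=3$); $\widehat T=[-1,1]^d$; $F_T:\widehat T\to T$ is the bi-/tri-linear bijective element mapping; $p_T\in\mathbb{N}$, $p_T\ge1$, is the polynomial degree of $T$ (degrees of neighboring elements being comparable). $\mathbb{P}_r(\widehat T)$ is the space of polynomials on $\widehat T$ of degree at most $r$ in each variable. $$Q_{hp}:=\{q\in Q: q|_T\circ F_T\in(\mathbb{P}_{p_T-1}(\widehat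 T))^{d\times d}\ \forall T\in\mathcal{T}_h\}.$$ For $T\in\mathcal{T}_h$, $\hat x_{k,T}$, $k=1,\dots,n_T:=p_T^d$, are the tensor product Gauss quadrature points on $\widehat T$ ($p_T$ per direction) with positive weights $\hat\omega_{k,T}$; point values at $F_T(\hat x_{k,T})$ are those of the restriction to $T$. The discrete plasticity functional is $$\psi_{hp}(q_{hp}):=\sum_{T\in\mathcal{T}_h}\mathcal{Q}_{hp,T}(\sigma_y|q_{hp}|_F),\qquad \mathcal{Q}_{hp,T}(\varphi):=\begin{cases}|T|\,\varphi(F_T(0)),&p_T=1,\\ \sum_{k=1}^{n_T}\hat\omega_{k,T}\,|\det\nabla F_T(\hat x_{k,T})|\,\varphi(F_T(\hat x_{k,T})),&p_T\ge2.\end{cases}$$ *)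

(* Defs.v *)
From HB Require Import structures.
From mathcomp Require Import all_boot all_order all_algebra.
From mathcomp Require Import all_classical all_reals all_analysis.
Import Order.TTheory GRing.Theory Num.Theory.
Import numFieldNormedType.Exports.

Set Implicit Arguments.
Unset Strict Implicit.
Unset Printing Implicit Defensive.

Local Open Scope classical_set_scope.
Local Open Scope ring_scope.

(** * Lebesgue measure on R^d *)

Definition measure_matrix_display : measure_display -> measure_display.
Proof. exact. Qed.

(* The product sigma-algebra, generated by the entries; for T = R these are the
   Borel sets of the matrix space. *)
Section measurable_matrix.
Context {disp} {T : measurableType disp} (m n : nat).

Definition mx_cylinders : set (set 'M[T]_(m, n)) :=
  [set A | exists i j, exists2 B : set T, measurable B &
     A = [set M : 'M[T]_(m, n) | B (M i j)]].

Let mx_measurable : set (set 'M[T]_(m, n)) := <<s mx_cylinders >>.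

Let mx_measurable0 : mx_measurable set0.
Proof. exact: sigma_algebra0. Qed.

Let mx_measurableC A : mx_measurable A -> mx_measurable (~` A).
Proof. exact: sigma_algebraC. Qed.

Let mx_measurable_bigcup (F : _^nat) : (forall i, mx_measurable (F i)) ->
  mx_measurable (\bigcup_i (F i)).
Proof. exact: sigma_algebra_bigcup. Qed.

HB.instance Definition _ := @isMeasurable.Build (measure_matrix_display disp)
  'M[T]_(m, n) mx_measurable mx_measurable0 mx_measurableC mx_measurable_bigcup.

Lemma measurable_mx_entry (i : 'I_m) (j : 'I_n) :
  measurable_fun setT (fun M : 'M[T]_(m, n) => M i j).
Proof.
move=> _ B mB; rewrite setTI; apply: sub_sigma_algebra.
by exists i, j, B.
Qed.

Lemma measurable_fun_mx disp' (T' : measurableType disp')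
    (f : T' -> 'M[T]_(m, n)) :
  (forall i j, measurable_fun setT (fun x => f x i j)) -> measurable_fun setT f.
Proof.
move=> mf; apply: (@measurability _ _ _ _ _ _ mx_cylinders) => // A.
move=> [_ [i [j [B mB ->]]] <-]; exact: mf.
Qed.

End measurable_matrix.

Section lebesgue_rV.
Context {R : realType}.

Definition rV_cons d (z : R * 'rV[R]_d) : 'rV[R]_d.+1 :=
  \row_i (if unlift ord0 i is Some j then z.2 0 j else z.1).

Definition rV_uncons d (v : 'rV[R]_d.+1) : R * 'rV[R]_d :=
  (v 0 0, \row_j v 0 (lift ord0 j)).

Lemma rV_consK d : cancel (@rV_cons d) (@rV_uncons d).
Proof.
move=> [x v]; congr (_, _); first by rewrite mxE unlift_none.
by apply/rowP => j; rewrite !mxE liftK.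
Qed.

Lemma measurable_rV_cons d : measurable_fun setT (@rV_cons d).
Proof.
apply: measurable_fun_mx => i j; rewrite /rV_cons.
case: (unliftP ord0 j) => [k ->|->].
- under eq_fun do rewrite mxE liftK.
  by apply: (@measurableT_comp _ _ _ _ _ _ (fun M : 'rV[R]_d => M 0 k));
    [exact: measurable_mx_entry|exact: measurable_snd].
- under eq_fun do rewrite mxE unlift_none.
  exact: measurable_fst.
Qed.

Lemma measurable_rV_uncons d : measurable_fun setT (@rV_uncons d).
Proof.
apply/measurable_fun_pairP; split; first exact: measurable_mx_entry.
apply: measurable_fun_mx => i j; rewrite /rV_uncons /=.
by under eq_fun do rewrite mxE; exact: measurable_mx_entry.
Qed.

Section step.
Context (d : nat) (mu : {sigma_finite_measure set 'rV[R]_d -> \bar R}).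

Definition leb_step : set 'rV[R]_d.+1 -> \bar R :=
  pushforward (@lebesgue_measure R \x mu)%E (@rV_cons d).

Let leb_step0 : leb_step set0 = 0%E.
Proof. by rewrite /leb_step /pushforward preimage_set0 measure0. Qed.

Let leb_step_ge0 A : (0 <= leb_step A)%E.
Proof. by rewrite /leb_step /pushforward measure_ge0. Qed.

Let leb_step_sigma_additive : semi_sigma_additive leb_step.
Proof.
move=> F mF tF mUF; rewrite /leb_step /pushforward preimage_bigcup.
apply: measure_semi_sigma_additive.
- by move=> n; rewrite -[X in measurable X]setTI; exact: measurable_rV_cons.
- apply/trivIsetP => /= i j _ _ ij; rewrite -preimage_setI.
  by move/trivIsetP : tF => ->//; rewrite preimage_set0.
- rewrite -preimage_bigcup -[X in measurable X]setTI.
  exact: measurable_rV_cons.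
Qed.

HB.instance Definition _ := isMeasure.Build _ _ _ leb_step
  leb_step0 leb_step_ge0 leb_step_sigma_additive.

Let leb_step_sigma_finite : sigma_finite setT leb_step.
Proof.
have /sigma_finiteP[A [TA ndA Aoo]] := sigma_finiteT (@lebesgue_measure R).
have /sigma_finiteP[B [TB ndB Boo]] := sigma_finiteT mu.
exists (fun n => @rV_uncons d @^-1` (A n `*` B n)).
  rewrite -preimage_bigcup (_ : \bigcup_n _ = setT) ?preimage_setT//.
  rewrite -setXTT TA TB predeqE => -[x y]; split.
    by move=> [n _ []/= ? ?]; split; exists n.
  move=> [/= [n _ Anx] [k _ Bky]]; exists (maxn n k) => //; split.
  - by move: x Anx; exact/subsetPset/ndA/leq_maxl.
  - by move: y Bky; exact/subsetPset/ndB/leq_maxr.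
move=> k; have [mA Ak] := Aoo k; have [mB Bk] := Boo k; split.
  by rewrite -[X in measurable X]setTI; apply: measurable_rV_uncons => //;
    exact: measurableX.
rewrite /leb_step /pushforward -comp_preimage.
rewrite (_ : _ \o _ = id); last by apply/funext => z; exact: rV_consK.
by rewrite preimage_id product_measure1E// lte_mul_pinfty// ge0_fin_numE.
Qed.

HB.instance Definition _ := Measure_isSigmaFinite.Build _ _ _ leb_step
  leb_step_sigma_finite.

End step.

(* R^(d+1) is identified with R x R^d, and R^0 is a point. *)
Fixpoint leb_rec d : {sigma_finite_measure set 'rV[R]_d -> \bar R} :=
  match d with
  | 0 => \d_(0 : 'rV[R]_0)
  | d'.+1 => leb_step (leb_rec d')
  end.

Definition leb d : set 'rV[R]_d -> \bar R := leb_rec d.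

HB.instance Definition _ d := SigmaFiniteMeasure.on (@leb d).

End lebesgue_rV.

Section definitions.
Context {R : realType}.

(** * Euclidean geometry *)

Definition frob_dot m n (A B : 'M[R]_(m, n)) : R := \sum_i \sum_j A i j * B i j.

(* On row vectors this is the Euclidean norm. *)
Definition frob m n (A : 'M[R]_(m, n)) : R := Num.sqrt (frob_dot A A).

Definition diam d (A : set 'rV[R]_d) : R :=
  sup [set frob (z.1 - z.2) | z in A `*` A].

(* Near every boundary point, Omega is the strict epigraph, in the direction of
   some unit vector e, of a Lipschitz function on the hyperplane orthogonal to
   e; the function is extended to R^d constantly along e. *)
Definition lipschitz_boundary d (Omega : set 'rV[R]_d) :=
  forall x0, closure Omega x0 -> ~ Omega° x0 ->
  exists (e : 'rV[R]_d) (g : 'rV[R]_d -> R^o),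
    [/\ frob e = 1, lipschitz g &
        \forall x \near x0,
          Omega x <-> g (x - frob_dot x e *: e) < frob_dot x e].

Definition bounded_lipschitz_domain d (Omega : set 'rV[R]_d) :=
  [/\ Omega !=set0, open Omega, connected Omega, bounded_set Omega &
      lipschitz_boundary Omega].

(** * Tensor product polynomials and Gauss quadrature *)

Definition ref_cube d : set 'rV[R]_d := [set x | forall j, -1 <= x 0 j <= 1].

Definition tensor_poly r d (c : {ffun 'I_d -> 'I_r.+1} -> R) (x : 'rV[R]_d) : R :=
  \sum_(a : {ffun 'I_d -> 'I_r.+1}) c a * \prod_j x 0 j ^+ a j.

(* f restricted to the reference cube is a polynomial of degree at most r in
   each variable *)
Definition poly_on_cube r d (f : 'rV[R]_d -> R) :=
  exists c : {ffun 'I_d -> 'I_r.+1} -> R,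
    forall x, ref_cube x -> f x = tensor_poly c x.

(* Rodrigues' formula *)
Definition legendre n : {poly R} :=
  (2 ^+ n * n`!%:R)^-1 *: (('X^2 - 1) ^+ n)^`(n).

Definition gauss_nodes n (xi : 'I_n -> R) :=
  injective xi /\ forall k, root (legendre n) (xi k).

(* The weight of a node is the integral of its Lagrange basis polynomial. *)
Definition gauss_weight n (xi : 'I_n -> R) (k : 'I_n) : R :=
  \int[@lebesgue_measure R]_(t in `[-1, 1])
    \prod_(l | l != k) ((t - xi l) / (xi k - xi l)).

(* The n ^ d tensor product points are indexed by {ffun 'I_d -> 'I_n}. *)
Definition gauss_point n d (xi : 'I_n -> R) (k : {ffun 'I_d -> 'I_n}) : 'rV[R]_d :=
  \row_j xi (k j).

Definition tensor_weight n d (xi : 'I_n -> R) (k : {ffun 'I_d -> 'I_n}) : R :=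
  \prod_j gauss_weight xi (k j).

(** * Meshes *)

(* 'J (F i) uses the row-vector convention, hence is the transpose of the
   usual gradient matrix; determinants and Frobenius norms are unaffected. *)
Definition det_grad d (F : 'rV[R]_d -> 'rV[R]_d) (x : 'rV[R]_d) : R :=
  \det (jacobian F x).

Section mesh.
Context (d : nat) (I : finType).
Variables (F : I -> 'rV[R]_d -> 'rV[R]_d) (p : I -> nat).

Definition elt (i : I) : set 'rV[R]_d := F i @` @ref_cube d.

(* gamma bounds the mesh constants: shape regularity (in the form that bounds
   the scaled gradients of the element maps and their inverses), local
   quasi-uniformity, and comparability of neighboring degrees.  Each F i is the
   multilinear polynomial map on all of R^d, so that its gradient makes sense
   up to the boundary of the reference cube.  Convexity makes the elements
   genuine quadrilaterals and hexahedra. *)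
Record fe_mesh (Omega : set 'rV[R]_d) (gamma : R) : Prop := FeMesh {
  mesh_multilinear : forall i j, exists c : {ffun 'I_d -> 'I_2} -> R,
    forall x, F i x 0 j = tensor_poly c x;
  mesh_inj : forall i, set_inj (@ref_cube d) (F i);
  mesh_convex : forall i, convex_set (elt i);
  mesh_cover : \bigcup_i elt i = closure Omega;
  mesh_disjoint : forall i j, i != j -> (elt i)° `&` (elt j)° = set0;
  mesh_shape_regular : forall i x, ref_cube x ->
    [/\ jacobian (F i) x \in unitmx,
        frob (jacobian (F i) x) <= gamma * diam (elt i) &
        frob (invmx (jacobian (F i) x)) <= gamma / diam (elt i)];
  mesh_quasi_uniform : forall i j, elt i `&` elt j !=set0 ->
    diam (elt i) <= gamma * diam (elt j);
  mesh_degree_gt0 : forall i, (0 < p i)%N;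
  mesh_degree_comparable : forall i j, elt i `&` elt j !=set0 ->
    (p i)%:R <= gamma * (p j)%:R }.

End mesh.

(** * Function spaces *)

(* Elements of L^2 are given by representatives; every notion below only
   depends on the class modulo equality almost everywhere in Omega. *)
Definition L2_S0 d (Omega : set 'rV[R]_d) : set ('rV[R]_d -> 'M[R]_d) :=
  [set q | [/\ measurable_fun Omega q,
     (\int[@leb R d]_(x in Omega) ((frob (q x) ^+ 2)%:E) < +oo)%E &
     {ae @leb R d, forall x, Omega x -> (q x)^T = q x /\ \tr (q x) = 0}]].

Definition L2_inner d (Omega : set 'rV[R]_d) (u v : 'rV[R]_d -> 'M[R]_d) : R :=
  \int[@leb R d]_(x in Omega) frob_dot (u x) (v x).

Section discrete.
Context (d : nat) (I : finType).
Variables (Omega : set 'rV[R]_d).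
Variables (F : I -> 'rV[R]_d -> 'rV[R]_d) (p : I -> nat).

(* g is the representative of q on the i-th element whose pullback to the
   reference cube is polynomial; its values on the element are determined by
   the class of q. *)
Definition elt_repr (q : 'rV[R]_d -> 'M[R]_d) (i : I) (g : 'rV[R]_d -> 'M[R]_d) :=
  (forall k l, poly_on_cube (p i).-1 (fun x => g (F i x) k l)) /\
  {ae @leb R d, forall x, elt F i x -> q x = g x}.

Definition Q_hp : set ('rV[R]_d -> 'M[R]_d) :=
  [set q | L2_S0 Omega q /\ forall i, exists g, elt_repr q i g].

Definition elt_restr (q : 'rV[R]_d -> 'M[R]_d) (i : I) : 'rV[R]_d -> 'M[R]_d :=
  xget (fun=> 0) [set g | elt_repr q i g].

Variable xi : forall n, 'I_n -> R.

Definition quad_hp (i : I) (phi : 'rV[R]_d -> R) : R :=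
  if p i == 1%N then fine (leb (elt F i)) * phi (F i 0)
  else \sum_(k : {ffun 'I_d -> 'I_(p i)})
         tensor_weight (@xi (p i)) k *
         `|det_grad (F i) (gauss_point (@xi (p i)) k)| *
         phi (F i (gauss_point (@xi (p i)) k)).

Variable sigma : R.

Definition psi_hp (q : 'rV[R]_d -> 'M[R]_d) : R :=
  \sum_i quad_hp i (fun x => sigma * frob (elt_restr q i x)).

Definition Lambda_s : set ('rV[R]_d -> 'M[R]_d) :=
  [set mu | Q_hp mu /\
     forall (i : I) (k : {ffun 'I_d -> 'I_(p i)}),
       frob (elt_restr mu i (F i (gauss_point (@xi (p i)) k))) <= sigma].

Definition Lambda_w : set ('rV[R]_d -> 'M[R]_d) :=
  [set mu | Q_hp mu /\
     forall q, Q_hp q -> L2_inner Omega mu q <= psi_hp q].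

End discrete.

End definitions.

(* Main.v *)
Require Import Defs.
From HB Require Import structures.
From mathcomp Require Import all_boot all_order all_algebra.
From mathcomp Require Import all_classical all_reals all_analysis.
From mathcomp Require Import measurable_realfun ring lra polyrcf.
Import Order.TTheory GRing.Theory Num.Theory.
Import numFieldNormedType.Exports.

(** Let x_k be the Gauss points of an element T, and let w_k > 0 be |T| if p = 1 and
    the Gauss weight times |det grad F_T| otherwise. The functional psi_hp is then
    the sum, over all elements and Gauss points, of w_k sigma_y |q(x_k)|. The heart
    of the matter is that the inner product of two discrete functions is exactly
    the sum of w_k mu(x_k) : q(x_k) (L2_inner_quadrature): pulled back to the
    reference cube, mu : q has degree at most 2 (p - 1) in each variable and the
    determinant has degree at most 1, so that the product has degree at most
    2 p - 1, up to which the p-point Gauss rule is exact; for p = 1 everything is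
    constant. Given this, the pointwise bound implies the weak one by the
    Cauchy-Schwarz inequality at each Gauss point. Conversely, testing with the
    discrete function whose only nonzero nodal value is V = mu(x_k) at x_k
    (nodal_test_function) leaves w_k |V|^2 <= w_k sigma_y |V|.

    The quadrature formula rests on the change of variables for an element map F
    (change_of_variables). On a cube of radius r around x0, F is a perturbation of
    its linear part A, and by the contraction principle the image of the cube lies
    between two parallelepipeds of relative sizes 1 - O(r) and 1 + O(r), whose
    volumes are known from scales_leb_mulmx. Hence the integral over the image of
    a box and the integral of the pullback times the determinant, which are both
    additive, agree up to O(r) relative error on cubes of radius r, and dyadic
    subdivision makes them equal. The integral over the cube is expressed by
    antiderivatives in each variable (sep_int), to which the exactness of the Gauss
    rule (gauss_exact) applies factor by factor.

    Two facts connect elements and domain. The domain is, up to a null set, the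
    disjoint union of the interiors of the elements (Rintegral_domain): the
    boundary of an element comes from the faces of the cube, and a Lipschitz domain
    is the interior of its closure. And the nodal values of a discrete function,
    which is given almost everywhere only, are well defined (elt_repr_nodes): a
    pullback of the right degree that vanishes almost everywhere has a square of
    integral 0, so by the quadrature formula it vanishes at all Gauss points. *)

Set Implicit Arguments.
Unset Strict Implicit.
Unset Printing Implicit Defensive.

Local Open Scope classical_set_scope.
Local Open Scope ring_scope.

(** * Lebesgue measure under affine maps *)

Lemma lebesgue_measure_affine (R : realType) (a b : R) (A : set R) : a != 0 ->
  measurable A ->
  lebesgue_measure ((fun t => a * t + b) @^-1` A) =
    ((`|a|^-1)%:E * lebesgue_measure A)%E.
Proof.
move=> a0 mA; pose f : R -> measurableTypeR R := fun t => a * t + b.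
have mf : measurable_fun setT f.
  by apply: measurable_funD => //; exact: measurable_funM.
have na0 : (0 <= `|a|)%R by [].
pose mu : {measure set (measurableTypeR R) -> \bar R} :=
  mscale (NngNum na0)
    (measure_function_pushforward__canonical__measure_function_Measure lebesgue_measure mf).
have muE B : mu B = (`|a|%:E * lebesgue_measure (f @^-1` B))%E by [].
have : lebesgue_measure A = mu A.
  apply: lebesgue_measure_unique => // _ [[x y] _ <-].
  rewrite muE.
  have [a_gt0|a_lt0|/eqP] := ltgtP 0 a; last by rewrite eq_sym (negbTE a0).
  - have -> : f @^-1` `]x, y] = `](x - b) / a, (y - b) / a]%classic.
      apply/seteqP; split=> t /=; rewrite !in_itv /= ltr_pdivrMr// ler_pdivlMr//;
      rewrite ltrBlDr lerBrDr /f mulrC //.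
    rewrite !lebesgue_measure_itv /= !lte_fin ltr_pM2r ?invr_gt0// ltrD2r.
    case: ifP => xy; last by rewrite mule0.
    rewrite -!EFinB -EFinM gtr0_norm//; congr _%:E; field; exact: lt0r_neq0.
  - have -> : f @^-1` `]x, y] = `[(y - b) / a, (x - b) / a[%classic.
      apply/seteqP; split=> t /=; rewrite !in_itv /= ler_ndivrMr// ltr_ndivlMr//;
      rewrite ltrBlDr lerBrDr /f mulrC andbC//.
    rewrite !lebesgue_measure_itv /= !lte_fin ltr_nM2r ?invr_lt0// ltrD2r.
    case: ifP => xy; last by rewrite mule0.
    rewrite -!EFinB -EFinM ltr0_norm//; congr _%:E; field; exact: ltr0_neq0.
move=> ->; rewrite muE muleA -EFinM.
by rewrite mulVf ?mul1e // normr_eq0.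
Qed.

Section leb_linear.
Context {R : realType}.

(** Preimages are measured, so an invertible matrix A has the factor |det A|^-1. *)
Definition scales_leb d (f : 'rV[R]_d -> 'rV[R]_d) (c : R) :=
  forall E, measurable E -> (leb (f @^-1` E) = c%:E * leb E)%E.

Lemma scales_leb_comp d (f g : 'rV[R]_d -> 'rV[R]_d) (a b : R) :
  measurable_fun setT g ->
  scales_leb f a -> scales_leb g b -> scales_leb (g \o f) (a * b).
Proof.
move=> mg fa gb E mE; rewrite comp_preimage fa ?gb ?EFinM ?muleA//.
by rewrite -[X in measurable X]setTI; exact: mg.
Qed.

Lemma leb_cons d (E : set 'rV[R]_d.+1) :
  leb E = (@lebesgue_measure R \x @leb R d)%E (@rV_cons R d @^-1` E).
Proof. by []. Qed.

Lemma measurable_preimage_rV_cons d (E : set 'rV[R]_d.+1) :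
  measurable E -> measurable (@rV_cons R d @^-1` E).
Proof. by move=> mE; rewrite -[X in measurable X]setTI; exact: measurable_rV_cons. Qed.

Lemma rV_unconsK d : cancel (@rV_uncons R d) (@rV_cons R d).
Proof.
move=> v; apply/rowP => j; rewrite mxE; case: (unliftP ord0 j) => [k ->|->] /=.
  by rewrite mxE.
by [].
Qed.

(** By Fubini, it suffices to know the factor on each slice with a fixed first
    coordinate. *)
Lemma scales_leb_tail d (phi : R -> 'rV[R]_d -> 'rV[R]_d) (c : R) : 0 <= c ->
  (forall t, scales_leb (phi t) c) ->
  scales_leb (fun x => rV_cons ((rV_uncons x).1, phi (rV_uncons x).1 (rV_uncons x).2)) c.
Proof.
move=> c0 phic E mE; rewrite !leb_cons /product_measure1.
set S := (@rV_cons R d @^-1` E).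
have mS : measurable S by exact: measurable_preimage_rV_cons.
rewrite -ge0_integralZl//; last first.
- exact: (measurable_fun_xsection (@leb_rec R d) mS).
apply: eq_integral => t _; rewrite /comp -(phic t); last exact: measurable_xsection.
rewrite !xsectionE; congr (leb _); by apply/funext => v; rewrite /S /preimage /mkset rV_consK.
Qed.

(** The other order of integration: slices on which only the first coordinate
    moves. *)
Lemma scales_leb_head d (psi : 'rV[R]_d -> R -> R) (c : R) : 0 <= c ->
  (forall v (A : set R), measurable A ->
    (lebesgue_measure (psi v @^-1` A) = c%:E * lebesgue_measure A)%E) ->
  measurable_fun setT (fun x : 'rV[R]_d.+1 => psi (rV_uncons x).2 (rV_uncons x).1) ->
  scales_leb (fun x => rV_cons (psi (rV_uncons x).2 (rV_uncons x).1, (rV_uncons x).2)) c.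
Proof.
move=> c0 phic mpsi E mE; rewrite !leb_cons.
have H2 X : measurable X -> ((@lebesgue_measure R \x @leb R d) X =
    (@lebesgue_measure R \x^ @leb R d) X)%E.
  move=> mX; apply: product_measure_unique => //= *; exact: product_measure2E.
set S := (@rV_cons R d @^-1` E).
have mS : measurable S by exact: measurable_preimage_rV_cons.
rewrite !H2//; last first.
  apply: measurable_preimage_rV_cons; rewrite -[X in measurable X]setTI.
  apply: measurableT_comp mE => //; first exact: measurable_rV_cons.
  apply/measurable_fun_pairP; split => //.
  by have /measurable_fun_pairP[] := @measurable_rV_uncons R d.
rewrite /product_measure2 -ge0_integralZl//; last first.
- exact: (measurable_fun_ysection (@lebesgue_measure R) mS).
apply: eq_integral => v _; rewrite /comp -(phic v); last exact: measurable_ysection.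
rewrite !ysectionE; congr (lebesgue_measure _); apply/funext => t.
by rewrite /S /preimage /mkset rV_consK.
Qed.

Lemma scales_leb_id d : scales_leb (@id 'rV[R]_d) 1.
Proof. by move=> E _; rewrite preimage_id mul1e. Qed.

Lemma measurable_rV_entry d (j : 'I_d) : measurable_fun setT (fun x : 'rV[R]_d => x 0 j).
Proof. exact: measurable_mx_entry. Qed.

Lemma measurable_rV_add d (c : 'rV[R]_d) : measurable_fun setT (fun x : 'rV[R]_d => x + c).
Proof.
apply: measurable_fun_mx => i j; under eq_fun do rewrite mxE.
by apply: measurable_funD => //; exact: measurable_mx_entry.
Qed.

Lemma measurable_rV_mulmx d n (A : 'M[R]_(d, n)) :
  measurable_fun setT (fun x : 'rV[R]_d => x *m A).
Proof.
apply: measurable_fun_mx => i j; under eq_fun do rewrite mxE.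
apply: measurable_sum => k; apply: measurable_funM => //; exact: measurable_mx_entry.
Qed.

Lemma scales_leb_translation d (c : 'rV[R]_d) : scales_leb (fun x => x + c) 1.
Proof.
elim: d c => [|d IHd] c.
  rewrite (_ : (fun _ => _) = id); first exact: scales_leb_id.
  by apply/funext => x; apply/rowP => -[].
pose f (x : 'rV[R]_d.+1) :=
  rV_cons ((rV_uncons x).1, (rV_uncons x).2 + (rV_uncons c).2).
pose g (x : 'rV[R]_d.+1) :=
  rV_cons ((rV_uncons x).1 + (rV_uncons c).1, (rV_uncons x).2).
have gE : measurable_fun setT (fun x : 'rV[R]_d.+1 => (rV_uncons x).1 + (rV_uncons c).1).
  by apply: measurable_funD => //; exact: measurable_rV_entry.
rewrite (_ : (fun _ => _) = g \o f); last first.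
  apply/funext => x; rewrite /comp /g /f rV_consK; apply/rowP => j; rewrite !mxE.
  by case: unliftP => [k ->|->]; rewrite /= ?mxE.
rewrite -(mulr1 1); apply: scales_leb_comp.
- apply: measurable_fun_mx => i j; under eq_fun do rewrite mxE.
  case: unliftP => [k _|_] //=.
  by under eq_fun do rewrite mxE; exact: measurable_mx_entry.
- exact: (@scales_leb_tail d (fun _ v => v + (rV_uncons c).2)).
- apply: (@scales_leb_head d (fun _ t => t + (rV_uncons c).1)) => // _ A mA.
  have := lebesgue_measure_affine (rV_uncons c).1 (oner_neq0 R) mA.
  rewrite normr1 invr1 => <-; congr (lebesgue_measure _).
  by apply/funext => t; rewrite /preimage /mkset mul1r.
Qed.

Lemma rV_cons_row d (t : R) (v : 'rV[R]_d) :
  rV_cons (t, v) = row_mx t%:M v :> 'rV[R]_(1 + d).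
Proof.
apply/rowP => j; rewrite mxE; case: (unliftP ord0 j) => [k ->|->] /=.
  by rewrite -rshift1 row_mxEr.
have -> : ord0 = lshift d 0 :> 'I_(1 + d) by apply/val_inj.
by rewrite row_mxEl mxE eqxx.
Qed.

(** Induction on the dimension. If the upper left entry a is not zero, the map is
    the composition of a shear of the first coordinate, of the Schur complement
    together with a translation on the slices t = constant, and of the scaling by
    a; each is covered by Fubini and the determinant is the product. *)
Lemma scales_leb_mulmx d (A : 'M[R]_d) : A \in unitmx ->
  scales_leb (fun x => x *m A) `|\det A|^-1.
Proof.
elim: d A => [|d IHd] A uA.
  rewrite (_ : (fun _ => _) = id); last by apply/funext => x; apply/rowP => -[].
  by rewrite det_mx00 normr1 invr1; exact: scales_leb_id.
have main (a : R) (b : 'rV[R]_d) (c : 'cV[R]_d) (D : 'M[R]_d) : a != 0 ->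
    (block_mx a%:M b c D : 'M[R]_(1 + d)) \in unitmx ->
    scales_leb (fun x : 'rV[R]_d.+1 => x *m (block_mx a%:M b c D : 'M[R]_(1 + d)))
      `|\det (block_mx a%:M b c D : 'M[R]_(1 + d))|^-1.
  move=> a0 uB; pose S := D - a^-1 *: (c *m b).
  have BE : block_mx a%:M b c D =
      block_mx 1%:M 0 (a^-1 *: c) 1%:M *m block_mx a%:M b 0 S :> 'M[R]_(1 + d).
    rewrite mulmx_block !mul1mx !mul0mx !addr0 mul_mx_scalar scalerA divff// scale1r.
    by rewrite /S -scalemxAl addrC subrK.
  have detB : \det (block_mx a%:M b c D : 'M[R]_(1 + d)) = a * \det S.
    by rewrite BE det_mulmx det_lblock det_ublock !det1 !mul1r det_scalar1.
  have uS : S \in unitmx.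
    by move: uB; rewrite !unitmxE detB unitrM => /andP[].
  pose f1 (x : 'rV[R]_d.+1) :=
    rV_cons ((rV_uncons x).1 + ((rV_uncons x).2 *m (a^-1 *: c)) 0 0, (rV_uncons x).2).
  pose f2 (x : 'rV[R]_d.+1) :=
    rV_cons ((rV_uncons x).1, (rV_uncons x).2 *m S + (rV_uncons x).1 *: b).
  pose f3 (x : 'rV[R]_d.+1) := rV_cons (a * (rV_uncons x).1, (rV_uncons x).2).
  have E3 : (fun x : 'rV[R]_d.+1 => x *m (block_mx a%:M b c D : 'M[R]_(1 + d))) = f3 \o (f2 \o f1).
    apply/funext => x; rewrite BE mulmxA /comp /f3 /f2 /f1 !rV_consK -{1}(rV_unconsK x).
    case: (rV_uncons x) => t v; rewrite [(t, v).1]/= [(t, v).2]/= !rV_cons_row.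
set s := t + _.
    have -> : row_mx t%:M v *m block_mx 1%:M 0 (a^-1 *: c) 1%:M = row_mx s%:M v.
      rewrite mul_row_block !mulmx1 mulmx0 add0r; congr row_mx.
      by rewrite [v *m _]mx11_scalar -raddfD.
    rewrite mul_row_block mulmx0 addr0 -scalar_mxM mulrC mul_scalar_mx.
    by rewrite addrC.
  have ms1 v (w : 'cV[R]_d) (A0 : set R) : measurable A0 ->
      lebesgue_measure ((fun t => t + (v *m w) 0 0) @^-1` A0) = (1%:E * lebesgue_measure A0)%E.
    move=> mA0; have := lebesgue_measure_affine ((v *m w) 0 0) (oner_neq0 R) mA0.
    rewrite normr1 invr1 => <-; congr (lebesgue_measure _).
    by apply/funext => t; rewrite /preimage /mkset mul1r.
  have m1 : measurable_fun setT (fun x : 'rV[R]_d.+1 => (rV_uncons x).1).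
    exact: measurable_rV_entry.
  have m2 : measurable_fun setT (fun x : 'rV[R]_d.+1 => (rV_uncons x).2).
    by have /measurable_fun_pairP[] := @measurable_rV_uncons R d.
  have mcons (g : 'rV[R]_d.+1 -> R) (h : 'rV[R]_d.+1 -> 'rV[R]_d) :
      measurable_fun setT g -> measurable_fun setT h ->
      measurable_fun setT (fun x => rV_cons (g x, h x)).
    move=> mg mh; apply: measurableT_comp; first exact: measurable_rV_cons.
    exact/measurable_fun_pairP.
  rewrite E3 detB normrM invfM.
  rewrite -[`|\det S|^-1]mulr1 mulrC; apply: scales_leb_comp.
  - by apply: (mcons (fun x => a * (rV_uncons x).1)) => //; exact: measurable_funM.
  - rewrite mulrC; apply: scales_leb_comp.
    + apply: (mcons _ (fun x => (rV_uncons x).2 *m S + (rV_uncons x).1 *: b)) => //.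
      apply: measurable_fun_mx => i j.
      under eq_fun do rewrite mxE [X in _ + X]mxE.
      apply: measurable_funD; last by apply: measurable_funM => //; exact: measurable_cst.
      apply: (measurableT_comp (@measurable_mx_entry _ _ _ _ i j)).
      exact: (measurableT_comp (measurable_rV_mulmx _) m2).
    + apply: (@scales_leb_head d (fun v t => t + (v *m (a^-1 *: c)) 0 0)) => //.
        by move=> v B; exact: ms1.
      apply: measurable_funD => //.
      apply: (measurableT_comp (@measurable_mx_entry _ _ _ _ 0 0)).
      exact: (measurableT_comp (measurable_rV_mulmx _) m2).
    + apply: (@scales_leb_tail d (fun t v => v *m S + t *: b)) => // t.
      rewrite -[X in scales_leb _ X]mulr1.
      apply: (@scales_leb_comp _ (fun v => v *m S) (fun v => v + t *: b)).
      * exact: measurable_rV_add.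
      * exact: IHd.
      * exact: scales_leb_translation.
  - apply: (@scales_leb_head d (fun v t => a * t)) => //.
      move=> _ B mB; rewrite -(lebesgue_measure_affine 0 a0 mB); congr (lebesgue_measure _).
      by apply/funext => t; rewrite /preimage /mkset addr0.
    exact: measurable_funM.
pose B : 'M[R]_(1 + d) := A; have uB : B \in unitmx by [].
have BE : B = block_mx (ulsubmx B 0 0)%:M (ursubmx B) (dlsubmx B) (drsubmx B).
  by rewrite -mx11_scalar submxK.
change (scales_leb (fun x : 'rV[R]_d.+1 => x *m B) `|\det B|^-1).
have [a0|a0] := eqVneq (ulsubmx B 0 0) 0; last by rewrite BE; apply: main; rewrite -?BE.
(* With a zero pivot, first add to row 0 of B the combination of the other rows
   whose coefficients are the entries of column 0: the pivot becomes the squared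
   norm of that column, which an invertible matrix cannot annihilate. *)
set b := ursubmx B in BE; set c := dlsubmx B in BE; set D := drsubmx B in BE.
rewrite a0 in BE; have c0 : c != 0.
  apply: contraTneq uB => c0.
  by rewrite BE c0 unitmxE det_ublock det_scalar1 mul0r unitr0.
pose s := (c^T *m c) 0 0.
have s0 : s != 0.
  apply: contra c0 => /eqP; rewrite /s mxE => s0.
  apply/eqP/colP => i; rewrite [RHS]mxE; apply/eqP; rewrite -sqrf_eq0; apply/eqP.
  have /psumr_eq0P/(_ s0 i isT) : forall j, true -> 0 <= c^T 0 j * c j 0.
    by move=> j _; rewrite mxE -expr2 sqr_ge0.
  by rewrite mxE -expr2.
pose U : 'M[R]_(1 + d) := block_mx 1%:M c^T 0 1%:M.
have UBE : U *m B = block_mx s%:M (b + c^T *m D) c D.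
  rewrite BE /U mulmx_block !mul1mx !mul0mx raddf0 ?mul0mx !add0r.
  by rewrite -mx11_scalar.
have detU : \det U = 1 by rewrite det_ublock !det1 mulr1.
have uUB : U *m B \in unitmx by rewrite unitmx_mul uB andbT unitmxE detU unitr1.
rewrite -[\det B]mul1r -detU -det_mulmx -[X in scales_leb _ X]mul1r.
rewrite UBE in uUB *.
pose f0 (x : 'rV[R]_d.+1) := rV_cons ((rV_uncons x).1, (rV_uncons x).2 - (rV_uncons x).1 *: c^T).
rewrite (_ : (fun _ => _) = (fun x : 'rV[R]_d.+1 =>
    x *m (block_mx s%:M (b + c^T *m D) c D : 'M[R]_(1 + d))) \o f0); last first.
  apply/funext => x; rewrite -UBE /comp mulmxA /f0; congr (_ *m _).
  rewrite -{1}(rV_unconsK x).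
  case: (rV_uncons x) => t v; rewrite [(t, v).1]/= [(t, v).2]/= !rV_cons_row.
  rewrite [RHS](mul_row_block t%:M (v - t *: c^T) 1%:M c^T 0 1%:M).
  by rewrite !mulmx1 mulmx0 addr0 mul_scalar_mx addrC subrK.
apply: scales_leb_comp.
- exact: measurable_rV_mulmx.
- apply: (@scales_leb_tail d (fun t v => v - t *: c^T)) => // t.
  exact: scales_leb_translation.
- exact: main.
Qed.

End leb_linear.

(** * Boxes, Borel sets and parallelepipeds *)

Section boxes.
Context {R : realType}.

Definition box d (a b : 'rV[R]_d) : set 'rV[R]_d :=
  [set x | forall j, a 0 j <= x 0 j <= b 0 j].

Lemma measurable_forall_entry d (P : 'I_d -> set R) : (forall j, measurable (P j)) ->
  measurable [set x : 'rV[R]_d | forall j, P j (x 0 j)].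
Proof.
move=> mP; rewrite (_ : mkset _ =
    ~` (\bigcup_(j in [set: 'I_d]) ((fun x : 'rV[R]_d => x 0 j) @^-1` (~` P j)))).
  apply: measurableC; apply: fin_bigcup_measurable => // j _.
  by rewrite -[X in measurable X]setTI; apply: measurable_rV_entry => //; exact: measurableC.
apply/seteqP; split => x /= H; first by move=> [j _]; apply; exact: H.
by move=> j; apply: contrapT => nP; apply: H; exists j.
Qed.

Lemma measurable_box d (a b : 'rV[R]_d) : measurable (box a b).
Proof.
rewrite (_ : box a b = [set x | forall j, `[a 0 j, b 0 j]%classic (x 0 j)]).
  apply: (@measurable_forall_entry _ (fun j => `[a 0 j, b 0 j]%classic)) => j.
  exact: measurable_itv.
by apply/seteqP; split => x /= H j; have := H j; rewrite /= in_itv.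
Qed.

Lemma leb_box d (a b : 'rV[R]_d) : (forall j, a 0 j <= b 0 j) ->
  leb (box a b) = (\prod_j (b 0 j - a 0 j))%:E.
Proof.
elim: d a b => [|d IHd] a b ab.
  have -> : box a b = setT by apply/seteqP; split => // x _ [].
  by rewrite big_ord0 /leb /= diracE in_setT.
rewrite leb_cons (_ : _ @^-1` _ =
    `[(rV_uncons a).1, (rV_uncons b).1] `*` box (rV_uncons a).2 (rV_uncons b).2).
  transitivity (@lebesgue_measure R `[(rV_uncons a).1, (rV_uncons b).1]%classic *
      leb (box (rV_uncons a).2 (rV_uncons b).2))%E.
    by apply: (product_measure1E lebesgue_measure (leb_rec d)) => //; exact: measurable_box.
  rewrite IHd; last by move=> j; rewrite !mxE.
  rewrite /= lebesgue_measure_itv /= big_ord_recl lte_fin EFinM EFinB.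
  under eq_bigr do rewrite !mxE.
  case: ifPn => //; rewrite -leNgt => ba; have -> : a 0 0 = b 0 0 by apply/le_anti; rewrite ab ba.
  by rewrite subee.
apply/seteqP; split => -[t v] /= H.
  split; first by have := H ord0; rewrite in_itv mxE unlift_none.
  by move=> j; have := H (lift ord0 j); rewrite !mxE liftK.
move=> j; rewrite mxE; case: (unliftP ord0 j) => [k ->|->] /=.
  by have := H.2 k; rewrite !mxE.
by have := H.1; rewrite in_itv.
Qed.

Lemma measurable_rV_ball d (x : 'rV[R]_d) (e : R) : measurable (ball x e).
Proof.
have [e0|e0] := ltP 0 e; last first.
  rewrite (_ : ball _ _ = set0)//; apply/seteqP; split => // y -[].
  by rewrite ltNge e0.
rewrite (_ : ball x e = [set y | forall j, ball (x 0 j) e (y 0 j)]).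
  by apply: (@measurable_forall_entry _ (fun j => ball (x 0 j) e)) => j; exact: measurable_ball.
apply/seteqP; split => y /=; first by move=> [_ H] j; exact: H.
by move=> H; split => // i j; rewrite (ord1 i); exact: H.
Qed.

(** Rational balls form a countable base of the topology. *)
Lemma measurable_open d (U : set 'rV[R]_d) : open U -> measurable U.
Proof.
move=> oU.
pose B (k : 'rV[rat]_d * nat) := ball (map_mx ratr k.1 : 'rV[R]_d) k.2.+1%:R^-1.
pose D := [set k | B k `<=` U].
have -> : U = \bigcup_(k in D) B k.
  apply/seteqP; split; last by move=> x [k Dk] /Dk.
  move=> x Ux; have /nbhs_ballP[e /= e0 eU] : nbhs x U by apply: open_nbhs_nbhs.
  have [n ne] : exists n : nat, n.+1%:R^-1 < e / 2.
    have := near_infty_natSinv_lt (PosNum (divr_gt0 e0 (ltr0n R 2))).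
    by move=> [n _ /(_ n (leqnn n)) H]; exists n.
  have H j : exists q : rat, ball (x 0 j) n.+1%:R^-1 (ratr q : R).
    have : x 0 j - n.+1%:R^-1 < x 0 j + n.+1%:R^-1.
      by rewrite ltrD2l gtrN// invr_gt0.
    move=> /rat_in_itvoo[q]; rewrite inE => qx; exists q.
    by rewrite /ball /= distrC ltr_distl !(itvP qx).
  have [q Hq] := choice H.
  have Bx : B (\row_j q j, n) x.
    split; first by rewrite invr_gt0.
    by move=> i j; rewrite (ord1 i) !mxE; apply: ball_sym; exact: Hq.
  exists (\row_j q j, n) => // y By; apply: eU.
  apply: (@ball_splitr _ _ (map_mx ratr (\row_j q j) : 'rV[R]_d)).
    exact: (le_ball (ltW ne) Bx).
  exact: (le_ball (ltW ne) By).
rewrite bigcup_mkcond; apply: countable_bigcupT_measurable; first exact: countableP.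
by move=> k; case: ifP => // _; exact: measurable_rV_ball.
Qed.

Lemma measurable_closed d (K : set 'rV[R]_d) : closed K -> measurable K.
Proof.
move=> cK; rewrite -(setCK K); apply: measurableC; apply: measurable_open.
exact: closed_openC.
Qed.

Lemma measurable_compact d (K : set 'rV[R]_d) : compact K -> measurable K.
Proof. by move=> cK; apply: measurable_closed; apply: compact_closed cK; apply: norm_hausdorff. Qed.

(** The volume of a parallelepiped. *)
Lemma box_image_affine d (A : 'M[R]_d) (c x0 : 'rV[R]_d) (r : R) :
  0 <= r -> A \in unitmx ->
  let P := (fun x => (x - x0) *m A + c) @` box (x0 - const_mx r) (x0 + const_mx r) in
  measurable P /\ leb P = (`|\det A| * (2 * r) ^+ d)%:E.
Proof.
move=> r0 uA; set Q := box _ _; cbv zeta; set P := _ @` _.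
have PE : P = (fun y => y *m invmx A) @^-1` ((fun y => y + (x0 - c *m invmx A)) @^-1` Q).
  apply/seteqP; split => y /=.
    move=> [x Qx <-]; rewrite mulmxDl mulmxK//.
    by rewrite addrACA subrK subrr addr0.
  move=> Qy; exists (y *m invmx A + (x0 - c *m invmx A)) => //.
  by rewrite addrA addrAC addrK -mulmxBl mulmxKV// subrK.
have uV : invmx A \in unitmx by rewrite unitmx_inv.
have mQ : measurable Q by exact: measurable_box.
have mQ' : measurable ((fun y => y + (x0 - c *m invmx A)) @^-1` Q).
  by rewrite -[X in measurable X]setTI; exact: measurable_rV_add.
rewrite PE; split.
  by rewrite -[X in measurable X]setTI; exact: measurable_rV_mulmx.
rewrite (scales_leb_mulmx uV)// (scales_leb_translation _ mQ) mul1e leb_box.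
  rewrite det_inv normfV invrK -EFinM; congr (_ * _)%:E.
  under eq_bigr do rewrite !mxE.
  rewrite (eq_bigr (fun=> 2 * r)); last by move=> j _; ring.
  by rewrite prodr_const card_ord.
by move=> j; rewrite !mxE lerD2l; apply: (le_trans _ r0); rewrite oppr_le0.
Qed.

End boxes.

(** * Functions with a Lipschitz gradient *)

Section C11.
Context {R : realType}.

Lemma ler_entry_norm d (x : 'rV[R]_d) j : `|x 0 j| <= `|x|.
Proof.
rewrite [leRHS]/Num.norm /= mx_normrE; apply/bigmax_geP; right => /=.
by exists (0, j).
Qed.

Lemma rV_norm_le d (x : 'rV[R]_d) (e : R) : 0 <= e ->
  (forall j, `|x 0 j| <= e) -> `|x| <= e.
Proof.
move=> e0 H; rewrite [leLHS]/Num.norm /= mx_normrE; apply/bigmax_leP; split => //=.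
by move=> [i j] _ /=; rewrite (ord1 i).
Qed.

Lemma norm_le2 d (x : 'rV[R]_d) : `|x| <= 1 -> `|x| <= 2.
Proof. by move=> /le_trans; apply; rewrite ler1n. Qed.

(** The gradient z is decoupled from the two points x and y, which is strict
    differentiability with a rate: this is what makes F a perturbation of its
    linear part on a whole small cube. The radius 2 keeps the points of the unit
    cube away from the boundary, so that they have a genuine differential. *)
Definition C11_grad d (f : 'rV[R]_d -> R) (g : 'rV[R]_d -> 'cV[R]_d) :=
  exists2 K : R, 0 <= K & forall x y z : 'rV[R]_d, `|x| <= 2 -> `|y| <= 2 -> `|z| <= 2 ->
    [/\ `|f x| <= K, `|f x - f y| <= K * `|x - y|,
        `|((x - y) *m g z) 0 0| <= K * `|x - y| &
        `|f x - f y - ((x - y) *m g z) 0 0| <= K * (`|x - z| + `|y - z|) * `|x - y|].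

Definition C11 d (f : 'rV[R]_d -> R) := exists g, C11_grad f g.

Lemma C11_cst d (c : R) : C11 (fun _ : 'rV[R]_d => c).
Proof.
exists (fun=> 0); exists `|c| => // x y z _ _ _.
by rewrite mulmx0 !mxE subrr subr0 normr0; split => //; rewrite ?mulr_ge0 ?addr_ge0.
Qed.

Lemma C11_entry d j : C11 (fun x : 'rV[R]_d => x 0 j).
Proof.
exists (fun=> delta_mx j 0); exists 2 => // x y z x2 y2 z2.
have -> : ((x - y) *m delta_mx j 0 : 'M[R]_(1, 1)) 0 0 = x 0 j - y 0 j.
  rewrite mxE (bigD1 j)//= big1 ?addr0.
    by rewrite !mxE !eqxx mulr1.
  by move=> k kj; rewrite !mxE (negbTE kj) mulr0.
have xy : `|x 0 j - y 0 j| <= 2 * `|x - y|.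
  have := ler_entry_norm (x - y) j; rewrite !mxE => /le_trans; apply.
  by rewrite ler_peMl// ler1n.
split => //; first exact: le_trans (ler_entry_norm _ _) _.
by rewrite subrr normr0 !mulr_ge0// addr_ge0.
Qed.

Let dotD d (h : 'rV[R]_d) (a b : R) (g1 g2 : 'cV[R]_d) :
  (h *m (a *: g1 + b *: g2)) 0 0 = a * (h *m g1) 0 0 + b * (h *m g2) 0 0.
Proof.
rewrite !mxE !big_distrr -big_split; apply: eq_bigr => i _; rewrite !mxE /=; ring.
Qed.

Lemma C11D d (f1 f2 : 'rV[R]_d -> R) : C11 f1 -> C11 f2 -> C11 (fun x => f1 x + f2 x).
Proof.
move=> [g1 [K1 K10 H1]] [g2 [K2 K20 H2]]; exists (fun x => 1 *: g1 x + 1 *: g2 x).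
exists (K1 + K2); first exact: addr_ge0.
move=> x y z x2 y2 z2; have [a1 a2 a3 a4] := H1 _ _ _ x2 y2 z2.
have [b1 b2 b3 b4] := H2 _ _ _ x2 y2 z2.
rewrite dotD !mul1r; split.
- exact: le_trans (ler_normD _ _) (lerD _ _).
- rewrite mulrDl opprD addrACA; exact: le_trans (ler_normD _ _) (lerD _ _).
- rewrite mulrDl; exact: le_trans (ler_normD _ _) (lerD _ _).
- have -> : forall a b c e s t : R, a + b - (c + e) - (s + t) = (a - c - s) + (b - e - t).
    by move=> *; ring.
  by rewrite -mulrA mulrDl !mulrA; exact: le_trans (ler_normD _ _) (lerD _ _).
Qed.

(** The product rule, with the remainder written as a combination of the two
    remainders and of increments of the factors. *)
Lemma C11M d (f1 f2 : 'rV[R]_d -> R) : C11 f1 -> C11 f2 -> C11 (fun x => f1 x * f2 x).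
Proof.
move=> [g1 [K1 K10 H1]] [g2 [K2 K20 H2]].
exists (fun x => f1 x *: g2 x + f2 x *: g1 x).
exists (3 * (K1 * K2)); first by rewrite !mulr_ge0.
move=> x y z x2 y2 z2.
have [a1 a2 a3 a4] := H1 _ _ _ x2 y2 z2.
have [b1 b2 b3 b4] := H2 _ _ _ x2 y2 z2.
have [az1 az2 _ _] := H1 _ _ _ z2 x2 z2.
have [bz1 bz2 _ _] := H2 _ _ _ z2 y2 z2.
have [by1 _ _ _] := H2 _ _ _ y2 y2 z2.
rewrite dotD.
rewrite (distrC z x) (distrC (f1 z)) in az2; rewrite (distrC z y) (distrC (f2 z)) in bz2.
move: (normr_ge0 (x - y)) (normr_ge0 (x - z)) (normr_ge0 (y - z)) => D0 u0 v0.
set D := `|x - y| in a2 a3 a4 b2 b3 b4 D0 *.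
set u := `|x - z| in a4 b4 az2 u0 *; set v := `|y - z| in a4 b4 bz2 v0 *.
set L1 := ((x - y) *m g1 z) 0 0 in a3 a4 *; set L2 := ((x - y) *m g2 z) 0 0 in b3 b4 *.
have K12 : 0 <= K1 * K2 by exact: mulr_ge0.
have pm (a b A B : R) : `|a| <= A -> `|b| <= B -> `|a * b| <= A * B.
  by move=> aA bB; rewrite normrM ler_pM.
have K12D := mulr_ge0 K12 D0.
split.
- apply: le_trans (pm _ _ _ _ a1 b1) _; lra.
- have -> : f1 x * f2 x - f1 y * f2 y = f1 x * (f2 x - f2 y) + (f1 x - f1 y) * f2 y by ring.
  apply: le_trans (ler_normD _ _) _.
  apply: le_trans (lerD (pm _ _ _ _ a1 b2) (pm _ _ _ _ a2 by1)) _; lra.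
- apply: le_trans (ler_normD _ _) _.
  apply: le_trans (lerD (pm _ _ _ _ az1 b3) (pm _ _ _ _ bz1 a3)) _; lra.
have -> : f1 x * f2 x - f1 y * f2 y - (f1 z * L2 + f2 z * L1) =
   (f1 x * (f2 x - f2 y - L2) + (f1 x - f1 z) * L2)
   + (f2 y * (f1 x - f1 y - L1) + (f2 y - f2 z) * L1) by ring.
apply: le_trans (ler_normD _ _) _.
apply: le_trans (lerD (ler_normD _ _) (ler_normD _ _)) _.
apply: le_trans (lerD (lerD (pm _ _ _ _ a1 b4) (pm _ _ _ _ az2 b3))
   (lerD (pm _ _ _ _ by1 a4) (pm _ _ _ _ bz2 a3))) _.
by rewrite le_eqVlt; apply/orP; left; apply/eqP; ring.
Qed.

Lemma C11_sum d (J : Type) (s : seq J) (f : J -> 'rV[R]_d -> R) :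
  (forall i, C11 (f i)) -> C11 (fun x => \sum_(i <- s) f i x).
Proof.
move=> Cf; elim: s => [|i s IHs].
  by under eq_fun do rewrite big_nil; exact: C11_cst.
by under eq_fun do rewrite big_cons; exact: C11D.
Qed.

Lemma C11_prod d (J : Type) (s : seq J) (f : J -> 'rV[R]_d -> R) :
  (forall i, C11 (f i)) -> C11 (fun x => \prod_(i <- s) f i x).
Proof.
move=> Cf; elim: s => [|i s IHs].
  by under eq_fun do rewrite big_nil; exact: C11_cst.
by under eq_fun do rewrite big_cons; exact: C11M.
Qed.

Lemma C11_horner d j (p : {poly R}) : C11 (fun x : 'rV[R]_d => p.[x 0 j]).
Proof.
elim/poly_ind: p => [|p c IHp].
  by under eq_fun do rewrite horner0; exact: C11_cst.
under eq_fun do rewrite hornerD hornerM hornerX hornerC.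
by apply: C11D; [apply: C11M => //; exact: C11_entry|exact: C11_cst].
Qed.

Lemma C11_tensor_poly r d (c : {ffun 'I_d -> 'I_r.+1} -> R) : C11 (tensor_poly c).
Proof.
apply: C11_sum => a; apply: C11M; first exact: C11_cst.
apply: C11_prod => j; under eq_fun do rewrite -hornerXn; exact: C11_horner.
Qed.

Definition C11_map_grad d n (F : 'rV[R]_d -> 'rV[R]_n) (G : 'rV[R]_d -> 'M[R]_(d, n)) :=
  exists2 K : R, 0 <= K & forall x y z : 'rV[R]_d, `|x| <= 2 -> `|y| <= 2 -> `|z| <= 2 ->
    `|F x - F y| <= K * `|x - y| /\
    `|F x - F y - (x - y) *m G z| <= K * (`|x - z| + `|y - z|) * `|x - y|.

Lemma C11_map d n (F : 'rV[R]_d -> 'rV[R]_n) : (forall j, C11 (fun x => F x 0 j)) ->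
  exists G, C11_map_grad F G.
Proof.
move=> CF.
have /choice[gK HgK] : forall j, exists gK : ('rV[R]_d -> 'cV[R]_d) * R, 0 <= gK.2 /\
    forall x y z : 'rV[R]_d, `|x| <= 2 -> `|y| <= 2 -> `|z| <= 2 ->
    `|F x 0 j - F y 0 j| <= gK.2 * `|x - y| /\
    `|F x 0 j - F y 0 j - ((x - y) *m gK.1 z) 0 0| <= gK.2 * (`|x - z| + `|y - z|) * `|x - y|.
  move=> j.
  have [g [K K0 H]] := CF j; exists (g, K); split => // x y z x2 y2 z2.
  by have [] := H x y z x2 y2 z2.
pose K := \sum_j (gK j).2.
have K0 : 0 <= K by apply: sumr_ge0 => j _; have [] := HgK j.
have leK j : (gK j).2 <= K.
  by rewrite /K (bigD1 j)//= lerDl sumr_ge0// => i _; have [] := HgK i.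
exists (fun z => \matrix_(i, j) (gK j).1 z i 0); exists K => // x y z x2 y2 z2.
split; (apply: rV_norm_le => [|j]; first by rewrite !mulr_ge0 ?addr_ge0).
- have [_ /(_ x y z x2 y2 z2)[+ _]] := HgK j; rewrite !mxE => /le_trans; apply.
  by rewrite ler_wpM2r.
- have [_ /(_ x y z x2 y2 z2)[_ +]] := HgK j; rewrite !mxE.
  under eq_bigr do rewrite !mxE.
  under [X in _ -> `|_ - X| <= _]eq_bigr do rewrite !mxE.
  by move=> /le_trans; apply; rewrite -!mulrA ler_wpM2r// mulr_ge0 ?addr_ge0.
Qed.

Lemma mulmx_norm_le d n (A : 'M[R]_(d, n)) (e : R) : 0 <= e ->
  (forall i j, `|A i j| <= e) ->
  forall h : 'rV[R]_d, `|h *m A| <= d%:R * e * `|h|.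
Proof.
move=> e0 Ae h; apply: rV_norm_le => [|j]; first by rewrite !mulr_ge0.
rewrite mxE; apply: le_trans (ler_norm_sum _ _ _) _.
rewrite -mulrA mulr_natl -[X in _ *+ X](card_ord d) -sumr_const.
apply: ler_sum => i _; rewrite normrM mulrC ler_pM//.
exact: ler_entry_norm.
Qed.

(** Taking y = z in the definition of C11_map_grad bounds the remainder of the
    first order expansion at z by a multiple of the squared distance. *)
Lemma jacobian_C11_map d (F : 'rV[R]_d -> 'rV[R]_d) G (z : 'rV[R]_d) :
  C11_map_grad F G -> `|z| < 2 -> jacobian F z = G z.
Proof.
move=> [K K0 HK] z2.
pose M := \sum_i \sum_j `|G z i j|.
have M0 : 0 <= M by apply: sumr_ge0 => i _; apply: sumr_ge0.
have leM i j : `|G z i j| <= M.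
  rewrite /M (bigD1 i)//= (bigD1 j)//= -addrA lerDl addr_ge0// sumr_ge0// => *.
  by rewrite sumr_ge0.
have lin : continuous (mulmxr (G z) : 'rV[R]_d -> 'rV[R]_d).
  apply: bounded_linear_continuous; apply/linear_boundedP.
  near=> r => x; apply: le_trans (mulmx_norm_le M0 _ _) _ => //.
  by rewrite ler_wpM2r//; near: r; apply: nbhs_pinfty_ge; rewrite num_real.
suff H : 'd F z = mulmxr (G z) :> (_ -> _).
  apply/row_matrixP => i; rewrite !rowE mul_rV_lin1 /= .
  by rewrite H /=.
apply: diff_unique => //.
apply/eqaddoP => e e0.
have K1 : 0 < K + 1 by rewrite ltr_wpDl.
suff H : \forall h \near (0 : 'rV[R]_d), 
    `|(F \o shift z - (cst (F z) + mulmxr (G z))) h| <= e * `|h| by exact: H.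
have N1 : \forall h \near (0 : 'rV[R]_d), `|h| < 2 - `|z|.
  by apply: nbhs0_lt; rewrite subr_gt0.
have N2 : \forall h \near (0 : 'rV[R]_d), `|h| <= e / (K + 1).
  by apply: nbhs0_le; exact: divr_gt0.
apply: filterS2 N1 N2 => h hsmall he.
rewrite !fctE /=.
have zh : `|h + z| <= 2.
  by apply: le_trans (ler_normD _ _) _; rewrite -lerBrDr ltW.
have [_] := HK (h + z) z z zh (ltW z2) (ltW z2).
rewrite addrK subrr normr0 addr0 opprD addrA => /le_trans; apply.
rewrite ler_wpM2r//; apply: (@le_trans _ _ ((K + 1) * `|h|)).
  by rewrite ler_wpM2r// lerDl.
by rewrite mulrC -ler_pdivlMr.
Unshelve. all: by end_near. Qed.

End C11.

(** * Images of small cubes *)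

HB.instance Definition _ (R : realType) m n := Complete.on 'M[R]_(m, n).

Section estimates.
Context {R : realType}.

Lemma expr1D_le (n : nat) (t : R) : 0 <= t <= 1 -> (1 + t) ^+ n <= 1 + 3 ^+ n * t.
Proof.
move=> /andP[t0 t1]; elim: n => [|n IHn]; first by rewrite !expr0 mul1r lerDl.
rewrite exprS; apply: le_trans (ler_wpM2l _ IHn) _; first by rewrite addr_ge0.
rewrite exprS; have : 1 <= 3 ^+ n :> R by rewrite exprn_ege1// ler1n.
move: (3 ^+ n) => c c1.
have h1 : 0 <= (c - 1) * t by rewrite mulr_ge0// subr_ge0.
have h2 : 0 <= c * (t * (1 - t)).
  by apply: mulr_ge0; [exact: le_trans c1|apply: mulr_ge0; rewrite ?subr_ge0].
rewrite -subr_ge0; lra.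
Qed.

Lemma expr1B_ge (n : nat) (t : R) : 0 <= t <= 1 -> 1 - 3 ^+ n * t <= (1 - t) ^+ n.
Proof.
move=> /andP[t0 t1]; elim: n => [|n IHn]; first by rewrite !expr0 mul1r gerBl.
rewrite !exprS; apply: (@le_trans _ _ ((1 - t) * (1 - 3 ^+ n * t))); last first.
  by rewrite ler_wpM2l// subr_ge0.
have : 1 <= 3 ^+ n :> R by rewrite exprn_ege1// ler1n.
move: (3 ^+ n) => c c1.
have h1 : 0 <= (c - 1) * t by rewrite mulr_ge0// subr_ge0.
have h2 : 0 <= c * (t * (1 - t)).
  by apply: mulr_ge0; [exact: le_trans c1|apply: mulr_ge0; rewrite ?subr_ge0].
have h3 : 0 <= c * t ^+ 2 by rewrite mulr_ge0 ?sqr_ge0 ?(le_trans ler01).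
rewrite -subr_ge0; lra.
Qed.

Lemma box_cubeE d (x0 : 'rV[R]_d) (r : R) : 0 <= r ->
  box (x0 - const_mx r) (x0 + const_mx r) = [set x | `|x - x0| <= r].
Proof.
move=> r0; apply/seteqP; split => x /= H.
  apply: rV_norm_le => // j; have := H j; rewrite !mxE ler_norml => /andP[h1 h2].
  by apply/andP; split; lra.
move=> j; have := le_trans (ler_entry_norm _ j) H; rewrite !mxE ler_norml => /andP[h1 h2].
by apply/andP; split; lra.
Qed.

Lemma compact_box d (a b : 'rV[R]_d) : compact (box a b).
Proof.
apply: (@rV_compact R d (fun j => `[a 0 j, b 0 j]%classic)) => j.
exact: segment_compact.
Qed.

End estimates.

(** On the cube of radius r around x0, x |-> F x A^-1 differs from the identity by
    a map with Lipschitz constant eta = 2 K L r. *)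
Section local_inversion.
Context {R : realType} (d : nat).
Variables (F : 'rV[R]_d -> 'rV[R]_d) (A : 'M[R]_d) (x0 : 'rV[R]_d) (r K L : R).
Hypotheses (r0 : 0 <= r) (K0 : 0 <= K) (L0 : 0 <= L) (uA : A \in unitmx).
Hypothesis invA : forall h : 'rV[R]_d, `|h *m invmx A| <= L * `|h|.
Hypothesis FA : forall x y, `|x - x0| <= r -> `|y - x0| <= r ->
  `|F x - F y - (x - y) *m A| <= K * (`|x - x0| + `|y - x0|) * `|x - y|.

Let eta := 2 * K * L * r.

Lemma local_inverse_lipschitz x y : `|x - x0| <= r -> `|y - x0| <= r ->
  `|(F x - F y) *m invmx A - (x - y)| <= eta * `|x - y|.
Proof.
move=> xr yr.
have -> : (F x - F y) *m invmx A - (x - y) = (F x - F y - (x - y) *m A) *m invmx A.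
  by rewrite [in RHS]mulmxBl mulmxK.
apply: le_trans (invA _) _.
apply: le_trans (ler_wpM2l L0 (FA xr yr)) _.
rewrite mulrA ler_wpM2r// /eta mulrA [leRHS](_ : _ = L * K * (r + r)); last by ring.
by rewrite ler_wpM2l ?mulr_ge0 ?lerD.
Qed.

(** The image of the cube of radius rho under the affine map
    h |-> h A + F x0. *)
Definition parallelepiped (rho : R) : set 'rV[R]_d :=
  [set y | `|(y - F x0) *m invmx A| <= rho].

Lemma image_sub_parallelepiped x :
  `|x - x0| <= r -> parallelepiped ((1 + eta) * r) (F x).
Proof.
move=> xr; rewrite /parallelepiped /=.
have x0r : `|x0 - x0| <= r by rewrite subrr normr0.
have H := local_inverse_lipschitz xr x0r.
rewrite -[X in `|X| <= _](subrK (x - x0)).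
apply: le_trans (ler_normD _ _) _; rewrite mulrDl mul1r addrC lerD//.
apply: le_trans H _; rewrite ler_wpM2l// !mulr_ge0//.
Qed.

(** To solve F x = y, iterate x |-> x - (F x - y) A^-1: its Lipschitz constant is
    eta, and it maps the cube to itself precisely because y lies in the
    parallelepiped of size (1 - eta) r. *)
Lemma parallelepiped_sub_image y : eta < 1 -> parallelepiped ((1 - eta) * r) y ->
  exists2 x, `|x - x0| <= r & F x = y.
Proof.
move=> eta1 yP; pose U := [set x : 'rV[R]_d | `|x - x0| <= r].
pose Phi x := x - (F x - y) *m invmx A.
have eta0 : 0 <= eta by rewrite !mulr_ge0.
have x0r : `|x0 - x0| <= r by rewrite subrr normr0.
have PhiU : {homo Phi : x / U x >-> U x}.
  move=> x Ux; rewrite /U /=.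
  have -> : Phi x - x0 = - ((F x - F x0) *m invmx A - (x - x0)) + (y - F x0) *m invmx A.
    rewrite /Phi !mulmxBl; move: (F x *m _) (F x0 *m _) (y *m _) => a b c.
    by apply/rowP => j; rewrite !mxE; ring.
  apply: le_trans (ler_normD _ _) _; rewrite normrN -[leRHS](subrK ((1 - eta) * r)).
  rewrite lerD//; apply: le_trans (local_inverse_lipschitz Ux x0r) _.
  by rewrite mulrBl mul1r opprB addrCA subrr addr0 ler_wpM2l.
pose f := mkfun PhiU.
have [|||p Up pE] := @banach_fixed_point R 'rV[R]_d U f.
- exists (NngNum eta0); split => // -[x x'] [/= Ux Ux'].
  have -> : Phi x - Phi x' = - ((F x - F x') *m invmx A - (x - x')).
    rewrite /Phi !mulmxBl; move: (F x *m _) (F x' *m _) (y *m _) => a b c.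
    by apply/rowP => j; rewrite !mxE; ring.
  by rewrite normrN; exact: local_inverse_lipschitz.
- rewrite (_ : U = closed_ball_ (@Num.norm R _) x0 r); last first.
    by apply/seteqP; split => x /=; rewrite /closed_ball_ /= distrC.
  exact: closed_closed_ball_.
- by exists x0.
exists p => //; move: pE; rewrite /= /Phi => /esym/eqP.
rewrite -subr_eq0 addrC addKr oppr_eq0 => /eqP /(congr1 (mulmx^~ A)).
by rewrite mulmxKV// mul0mx => /eqP; rewrite subr_eq0 => /eqP.
Qed.
Lemma leb_parallelepiped rho : 0 <= rho ->
  measurable (parallelepiped rho) /\
  leb (parallelepiped rho) = (`|\det A| * (2 * rho) ^+ d)%:E.
Proof.
move=> rho0; have := box_image_affine (F x0) 0 rho0 uA; cbv zeta.
rewrite sub0r add0r (_ : _ @` _ = parallelepiped rho)//.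
have := box_cubeE (0 : 'rV[R]_d) rho0; rewrite sub0r add0r => ->.
apply/seteqP; split => y /=; rewrite /parallelepiped /=.
  by move=> [x Qx <-]; rewrite addrK mulmxK.
move=> yP; exists ((y - F x0) *m invmx A); rewrite /= ?subr0//.
by rewrite mulmxKV// subrK.
Qed.

End local_inversion.

(** * Dyadic subdivision of boxes *)

Section dyadic.
Context {R : realType} (d : nat).
Implicit Types a b x : 'rV[R]_d.

Definition vol a b : R := \prod_j (b 0 j - a 0 j).

Definition set_entry a (j : 'I_d) (m : R) : 'rV[R]_d :=
  \row_k if k == j then m else a 0 k.

Lemma set_entryE a j m : set_entry a j m 0 j = m.
Proof. by rewrite mxE eqxx. Qed.

Lemma set_entry_neq a j m k : k != j -> set_entry a j m 0 k = a 0 k.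
Proof. by move=> kj; rewrite mxE (negbTE kj). Qed.

Lemma vol_split a b j m :
  vol a b = vol a (set_entry b j m) + vol (set_entry a j m) b.
Proof.
rewrite /vol !(bigD1 j (P := xpredT))//= !set_entryE.
rewrite [X in _ = _ * X + _](eq_bigr (fun k => b 0 k - a 0 k)); last first.
  by move=> k kj; rewrite set_entry_neq.
rewrite [X in _ = _ + _ * X](eq_bigr (fun k => b 0 k - a 0 k)); last first.
  by move=> k kj; rewrite set_entry_neq.
ring.
Qed.

Lemma box_split a b j m : a 0 j <= m <= b 0 j ->
  box a b = box a (set_entry b j m) `|` box (set_entry a j m) b.
Proof.
move=> /andP[am mb]; apply/seteqP; split => x /=.
  move=> H; have [xm|mx] := leP (x 0 j) m; [left|right] => k.
    have [->|kj] := eqVneq k j; last by rewrite set_entry_neq.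
    by rewrite set_entryE xm andbT; have /andP[] := H j.
  have [->|kj] := eqVneq k j; last by rewrite set_entry_neq.
  by rewrite set_entryE (ltW mx); have /andP[] := H j.
move=> [] H k; have := H k; (have [->|kj] := eqVneq k j; last by rewrite set_entry_neq);
  rewrite set_entryE => /andP[h1 h2].
  by rewrite h1 (le_trans h2).
by rewrite h2 (le_trans am).
Qed.

Lemma box_split_cap a b j m :
  box a (set_entry b j m) `&` box (set_entry a j m) b `<=` [set x | x 0 j = m].
Proof.
move=> x [/= /(_ j) + /(_ j)]; rewrite !set_entryE => /andP[_ h1] /andP[h2 _].
by apply/le_anti; rewrite h1 h2.
Qed.

Lemma norm_between a b x : `|a| <= 1 -> `|b| <= 1 -> box a b x -> `|x| <= 1.
Proof.
move=> a1 b1 H; apply: rV_norm_le => // j; have /andP[h1 h2] := H j.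
have := le_trans (ler_entry_norm _ j) a1; have := le_trans (ler_entry_norm _ j) b1.
rewrite !ler_norml => /andP[_ h3] /andP[h4 _].
by rewrite (le_trans h4 h1) (le_trans h2 h3).
Qed.

Lemma set_entry_norm a b j m : `|a| <= 1 -> `|b| <= 1 -> (forall k, a 0 k <= b 0 k) ->
  a 0 j <= m <= b 0 j -> `|set_entry a j m| <= 1 /\ `|set_entry b j m| <= 1.
Proof.
move=> a1 b1 ab am; split; apply: (norm_between a1 b1) => k;
  (have [->|kj] := eqVneq k j; first by rewrite set_entryE);
  by rewrite set_entry_neq// ab lexx.
Qed.

(** A property that is stable under cutting a box in two by a hyperplane needs to
    be checked only on cubes of side h; boxes with different dyadic side lengths
    are allowed so that thin slabs are covered too. *)
Lemma dyadic_ind (P : 'rV[R]_d -> 'rV[R]_d -> Prop) (h : R) : 0 < h ->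
  (forall a, `|a| <= 1 -> `|a + const_mx h| <= 1 -> P a (a + const_mx h)) ->
  (forall a b j m, `|a| <= 1 -> `|b| <= 1 -> (forall k, a 0 k <= b 0 k) ->
     a 0 j <= m <= b 0 j ->
     P a (set_entry b j m) -> P (set_entry a j m) b -> P a b) ->
  forall (n : 'I_d -> nat) a b, `|a| <= 1 -> `|b| <= 1 ->
    (forall j, b 0 j = a 0 j + h * 2 ^+ n j) -> P a b.
Proof.
move=> h0 base step n; move: {2}(\sum_j n j)%N (leqnn (\sum_j n j)) => N.
elim: N n => [|N IHN] n nN a b a1 b1 ab.
  have n0 j : n j = 0%N.
    by move: nN; rewrite leqn0 sum_nat_eq0 => /forallP/(_ j)/eqP.
  have bE : b = a + const_mx h.
    by apply/rowP => j; rewrite ab n0 expr0 mulr1 !mxE.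
  by rewrite bE; apply: base => //; rewrite -bE.
have [/forallP n0|] := boolP [forall j, n j == 0%N].
  by apply: (IHN n) => //; rewrite big1// => j _; apply/eqP.
move=> /forallPn/= [j nj]; rewrite -lt0n in nj.
pose n' := fun k => if k == j then (n j).-1 else n k.
have n'j : n' j = (n j).-1 by rewrite /n' eqxx.
have n'N : (\sum_k n' k <= N)%N.
  rewrite -ltnS; apply: leq_trans nN.
  rewrite [X in (X < _)%N](bigD1 j)//= [X in (_ < X)%N](bigD1 j)//=.
  rewrite n'j -addSn prednK// leq_add2l leq_sum// => k kj.
  by rewrite /n' (negbTE kj).
pose m := a 0 j + h * 2 ^+ (n j).-1.
have hj : h * 2 ^+ n j = h * 2 ^+ (n j).-1 + h * 2 ^+ (n j).-1.
  by rewrite -[in LHS](prednK nj) exprS; ring.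
have hp k : 0 <= h * 2 ^+ k by rewrite mulr_ge0 ?exprn_ge0 ?ltW.
have am : a 0 j <= m <= b 0 j by rewrite lerDl hp ab /m hj addrA lerDl hp.
have abk k : a 0 k <= b 0 k by rewrite ab lerDl.
have [am1 bm1] := set_entry_norm a1 b1 abk am.
apply: (step a b j m) => //.
- apply: (IHN n') => // k.
  have [->|kj] := eqVneq k j; first by rewrite set_entryE /n' eqxx.
  by rewrite set_entry_neq// ab /n' (negbTE kj).
- apply: (IHN n') => // k.
  have [->|kj] := eqVneq k j; first by rewrite set_entryE /n' eqxx ab /m hj addrA.
  by rewrite set_entry_neq// ab /n' (negbTE kj).
Qed.

End dyadic.

Lemma leb_le (R : realType) d (A B : set 'rV[R]_d) :
  measurable A -> measurable B -> A `<=` B -> (leb A <= leb B)%E.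
Proof. by move=> mA mB AB; apply: le_measure; rewrite ?inE. Qed.

Section chart.
Context {R : realType} (d : nat).

(** The quantitative content of a shape regular element map: K bounds the
    Lipschitz constants of F and of its gradient, L those of the inverses of the
    gradients. *)
Record chart (F : 'rV[R]_d -> 'rV[R]_d) (G : 'rV[R]_d -> 'M[R]_d) (K L : R) : Prop :=
  Chart {
  chart_K0 : 0 <= K;
  chart_L0 : 0 <= L;
  chart_C11 : forall x y z : 'rV[R]_d, `|x| <= 2 -> `|y| <= 2 -> `|z| <= 2 ->
    `|F x - F y| <= K * `|x - y| /\
    `|F x - F y - (x - y) *m G z| <= K * (`|x - z| + `|y - z|) * `|x - y|;
  chart_inv : forall x, `|x| <= 1 -> G x \in unitmx /\
    forall h : 'rV[R]_d, `|h *m invmx (G x)| <= L * `|h|;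
  chart_inj : forall x y, `|x| <= 1 -> `|y| <= 1 -> F x = F y -> x = y }.

Variables (F : 'rV[R]_d -> 'rV[R]_d) (G : 'rV[R]_d -> 'M[R]_d) (K L : R).
Hypothesis FG : chart F G K L.

Lemma lipschitz_cvg (V : normedModType R) (f : 'rV[R]_d -> V) (M : R) (x : 'rV[R]_d) :
  0 <= M -> `|x| < 2 ->
  (forall y, `|y| <= 2 -> `|f x - f y| <= M * `|x - y|) -> {for x, continuous f}.
Proof.
move=> M0 x2 Hf; apply/(@cvgrPdist_le _ _ _ (nbhs x)) => e e0.
have M1 : 0 < M + 1 by rewrite ltr_wpDl.
have near_le (t : R) : 0 < t -> \forall y \near x, `|x - y| <= t.
  by move=> t0; apply: (@cvgr_dist_le _ _ _ (nbhs x) _ id x _ t t0); exact: cvg_id.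
have N1 : \forall y \near x, `|x - y| <= 2 - `|x|.
  by apply: near_le; rewrite subr_gt0.
have N2 : \forall y \near x, `|x - y| <= e / (M + 1).
  by apply: near_le; exact: divr_gt0.
apply: filterS2 N1 N2 => y y2 ye; apply: le_trans (Hf _ _) _.
  rewrite -[y](subKr x); apply: le_trans (ler_normB _ _) _.
  by rewrite -lerBrDl.
apply: (@le_trans _ _ ((M + 1) * `|x - y|)); first by rewrite ler_wpM2r// lerDl.
by rewrite mulrC -ler_pdivlMr.
Qed.

Lemma chart_continuous x : `|x| < 2 -> {for x, continuous F}.
Proof.
move=> x2; apply: (lipschitz_cvg (chart_K0 FG) x2) => y y2.
by have [] := chart_C11 FG (ltW x2) y2 (ltW x2).
Qed.

Lemma compact_chart_image S : compact S -> (forall x, S x -> `|x| <= 1) -> compact (F @` S).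
Proof.
move=> cS S1; apply: continuous_compact => //.
apply: continuous_in_subspaceT => x; rewrite inE => /S1 x1.
by apply: chart_continuous; rewrite (le_lt_trans x1)// ltr1n.
Qed.

Lemma measurable_chart_image S : compact S -> (forall x, S x -> `|x| <= 1) -> measurable (F @` S).
Proof. by move=> cS S1; apply: measurable_compact; exact: compact_chart_image. Qed.

Lemma measurable_chart_box (a b : 'rV[R]_d) : `|a| <= 1 -> `|b| <= 1 -> measurable (F @` box a b).
Proof.
move=> a1 b1; apply: measurable_chart_image; first exact: compact_box.
by move=> x; exact: norm_between.
Qed.

(** A cube of radius r is mapped into a cube of radius K r, and
    subadditivity suffices to pass to dyadic boxes. *)
Lemma leb_chart_box_le (n : 'I_d -> nat) (h : R) (a b : 'rV[R]_d) :
  0 < h -> `|a| <= 1 -> `|b| <= 1 ->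
  (forall j, b 0 j = a 0 j + h * 2 ^+ n j) ->
  (leb (F @` box a b) <= (K ^+ d * vol a b)%:E)%E.
Proof.
move=> h0; apply: (@dyadic_ind _ _ (fun a b => leb (F @` box a b) <= (K ^+ d * vol a b)%:E)%E h h0).
  move=> {a b} a a1 ah1; pose r := h / 2; pose x0 := a + const_mx r.
  have r0 : 0 <= r by rewrite divr_ge0 ?(ltW h0).
  have bE : box a (a + const_mx h) = [set x | `|x - x0| <= r].
    rewrite -box_cubeE// /x0; congr box; apply/rowP => j; rewrite !mxE /r; lra.
  have x01 : `|x0| <= 1.
    by apply: (norm_between a1 ah1); rewrite bE /= subrr normr0.
  have sub : F @` box a (a + const_mx h) `<=`
      box (F x0 - const_mx (K * r)) (F x0 + const_mx (K * r)).
    rewrite box_cubeE ?(mulr_ge0 (chart_K0 FG) r0)// => _ [x xB <-] /=.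
    have x1 := norm_between a1 ah1 xB.
    have [|||+ _] := @chart_C11 _ _ _ _ FG x x0 x0; rewrite ?(le_trans x1) ?(le_trans x01) ?ler1n//.
    move=> /le_trans; apply; rewrite ler_wpM2l ?(chart_K0 FG)//.
    by move: xB; rewrite bE.
  apply: le_trans (leb_le _ _ sub) _.
  - exact: measurable_chart_box.
  - exact: measurable_box.
  rewrite leb_box; last first.
    by move=> j; rewrite !mxE; have := mulr_ge0 (chart_K0 FG) r0; lra.
  rewrite lee_fin /vol -[d in K ^+ d]card_ord -prodr_const -big_split /=.
  rewrite le_eqVlt; apply/orP; left; apply/eqP; apply: eq_bigr => j _.
  by rewrite !mxE /r; field.
move=> {}a {}b j m a1 b1 ab am H1 H2.
have [am1 bm1] := set_entry_norm a1 b1 ab am.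
rewrite (vol_split a b j m) mulrDr EFinD (box_split am) image_setU.
apply: le_trans (leeD H1 H2); apply: measureU2; exact: measurable_chart_box.
Qed.

End chart.

(** * Images of faces are negligible *)

Section measure_complements.
Context {R : realType}.

Lemma le0_of_dyadic_le (e C : R) (N0 : nat) :
  (forall N, (N0 <= N)%N -> e <= C / 2 ^+ N) -> e <= 0.
Proof.
move=> H; rewrite leNgt; apply/negP => e0.
have [n Cn] : exists n : nat, `|C| / e < n%:R.
  exists (Num.bound (`|C| / e)); rewrite archi_boundP//.
  by rewrite divr_ge0// ltW.
pose N := maxn N0 n; have := H N (leq_maxl _ _); apply/negP; rewrite -ltNge.
rewrite ltr_pdivrMr ?exprn_gt0// (le_lt_trans (ler_norm C))//.
rewrite mulrC -ltr_pdivrMr// (lt_le_trans Cn)//.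
apply: (@le_trans _ _ N%:R); first by rewrite ler_nat leq_maxr.
by rewrite -natrX ler_nat ltnW// ltn_expl.
Qed.

Lemma Rintegral_setU_null dp (T : measurableType dp) (mu : {measure set T -> \bar R})
    (A B : set T) (f : T -> R) :
  measurable A -> measurable B -> mu (A `&` B) = 0%E ->
  mu.-integrable (A `|` B) (EFin \o f) ->
  \int[mu]_(x in A `|` B) f x = \int[mu]_(x in A) f x + \int[mu]_(x in B) f x.
Proof.
move=> mA mB AB0 fi.
have mAB : measurable (A `&` B) by exact: measurableI.
have fB : mu.-integrable B (EFin \o f).
  by apply: integrableS fi => //; exact: measurableU.
have ABE : A `|` B = A `|` (B `\` (A `&` B)).
  apply/seteqP; split => x [Ax|Bx]; [by left| |by left|by right; case: Bx].
  by have [Ax|nAx] := pselect (A x); [left|right; split => // -[]].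
rewrite ABE in fi *; rewrite Rintegral_setU//.
- by rewrite /Rintegral -(negligible_integral mAB mB fB).
- exact: measurableD.
- by apply/disj_setPS => x [Ax [Bx]]; case.
Qed.

Lemma Rintegral_sum dp (T : measurableType dp) (mu : {measure set T -> \bar R})
    (D : set T) (J : Type) (s : seq J) (w : J -> T -> R) :
  measurable D -> (forall i, mu.-integrable D (EFin \o w i)) ->
  mu.-integrable D (EFin \o (fun x => \sum_(i <- s) w i x)) /\
  \int[mu]_(x in D) (\sum_(i <- s) w i x) = \sum_(i <- s) \int[mu]_(x in D) w i x.
Proof.
move=> mD wi; elim: s => [|i s [IHs1 IHs2]].
  split.
    rewrite (_ : _ \o _ = cst 0%E); first exact: integrable0.
    by apply/funext => x /=; rewrite big_nil.
  rewrite [RHS]big_nil; transitivity (\int[mu]_(x in D) (0 : R)).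
    by apply: eq_Rintegral => x _; rewrite big_nil.
  by rewrite Rintegral_cst// mul0r.
have -> : (fun x => \sum_(j <- i :: s) w j x) = (fun x => w i x + \sum_(j <- s) w j x).
  by apply/funext => x; rewrite big_cons.
split; first exact: (integrableD mD (wi i) IHs1).
by rewrite RintegralD// IHs2 big_cons.
Qed.

End measure_complements.

Section chart_measure.
Context {R : realType} (d : nat).
Variables (F : 'rV[R]_d -> 'rV[R]_d) (G : 'rV[R]_d -> 'M[R]_d) (K L : R).
Hypothesis FG : chart F G K L.

Lemma measurable_chart_face j (t : R) : `|t| <= 1 ->
  measurable (F @` [set x : 'rV[R]_d | `|x| <= 1 /\ x 0 j = t]).
Proof.
rewrite ler_norml => /andP[t1 t1']; set S := [set x : 'rV[R]_d | _].
pose a := set_entry (const_mx (-1)) j t; pose b := set_entry (const_mx 1) j t.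
have -> : S = box a b.
  apply/seteqP; split => x.
    move=> [x1 xt] k; have [->|kj] := eqVneq k j; first by rewrite !set_entryE xt lexx.
    rewrite !set_entry_neq// !mxE -ler_norml; exact: le_trans (ler_entry_norm _ _) x1.
  move=> H; split; last by apply/le_anti; have := H j; rewrite !set_entryE andbC.
  apply: rV_norm_le => // k; rewrite ler_norml; have := H k.
  have [->|kj] := eqVneq k j; last by rewrite !set_entry_neq// !mxE.
  by rewrite !set_entryE => /andP[h1 h2]; rewrite (le_trans t1 h1) (le_trans h2).
have ab1 (s : R) : `|s| <= 1 -> `|set_entry (const_mx s) j t| <= 1.
  move=> s1; apply: rV_norm_le => // k; have [->|kj] := eqVneq k j.
    by rewrite set_entryE ler_norml t1.
  by rewrite set_entry_neq// mxE.
by apply: (measurable_chart_box FG); apply: ab1; rewrite ?normrN normr1.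
Qed.

(** The face lies in slabs of thickness h, whose images have measure O(h). *)
Lemma leb_chart_face j (t : R) : `|t| <= 1 ->
  leb (F @` [set x : 'rV[R]_d | `|x| <= 1 /\ x 0 j = t]) = 0%E.
Proof.
move=> t1t; have mS := measurable_chart_face j t1t.
move: t1t mS; rewrite ler_norml => /andP[t1 t1']; set S := [set x : 'rV[R]_d | _] => mS.
have H N : (1 <= N)%N -> (leb (F @` S) <= ((K ^+ d * 2 ^+ d * 2) / 2 ^+ N)%:E)%E.
  move=> N1; pose h : R := 2 / 2 ^+ N.
  have h0 : 0 < h by rewrite divr_gt0 ?exprn_gt0.
  have h1 : h <= 1.
    by rewrite ler_pdivrMr ?exprn_gt0// mul1r -[leLHS]expr1 ler_weXn2l// ler1n.
  have [t' [t'1 [t'h t't]]] : exists t', -1 <= t' /\ t' + h <= 1 /\ t' <= t <= t' + h.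
    have [th|th] := leP (t + h) 1; first by exists t; split; [lra|split; [lra|lra]].
    by exists (t - h); split; [lra|split; [lra|lra]].
  pose a := set_entry (const_mx (-1)) j t'; pose b := set_entry (const_mx 1) j (t' + h).
  have a1 : `|a| <= 1.
    apply: rV_norm_le => // k; rewrite /a; have [->|kj] := eqVneq k j.
      by rewrite set_entryE ler_norml; apply/andP; split; lra.
    by rewrite set_entry_neq// mxE normrN normr1.
  have b1 : `|b| <= 1.
    apply: rV_norm_le => // k; rewrite /b; have [->|kj] := eqVneq k j.
      by rewrite set_entryE ler_norml; apply/andP; split; lra.
    by rewrite set_entry_neq// mxE normr1.
  pose n k := if k == j then 0%N else N.
  have bn k : b 0 k = a 0 k + h * 2 ^+ n k.
    rewrite /a /b /n; have [->|kj] := eqVneq k j; first by rewrite !set_entryE expr0 mulr1.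
    rewrite !set_entry_neq// !mxE /h mulrVK ?unitfE ?expf_neq0//; lra.
  have sub : F @` S `<=` F @` box a b.
    apply: image_subset => x [x1 xt] k; rewrite /a /b; have [->|kj] := eqVneq k j.
      by rewrite !set_entryE xt t't.
    by rewrite !set_entry_neq// !mxE -ler_norml; exact: le_trans (ler_entry_norm _ _) x1.
  apply: le_trans (leb_le _ _ sub) _ => //; first exact: (measurable_chart_box FG).
  apply: le_trans (leb_chart_box_le FG h0 a1 b1 bn) _.
  rewrite lee_fin -2!mulrA ler_wpM2l ?exprn_ge0 ?(chart_K0 FG)//.
  rewrite /vol (bigD1 j)//= bn /n eqxx expr0 mulr1 addrAC subrr add0r mulrC ler_wpM2r ?(ltW h0)//.
  rewrite (eq_bigr (fun=> 2)); last first.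
    by move=> k kj; rewrite bn /n (negbTE kj) addrAC subrr add0r /h mulrVK ?unitfE ?expf_neq0.
  rewrite prodr_const ler_weXn2l ?ler1n//.
  by apply: leq_trans (max_card _) _; rewrite card_ord.
have fin : leb (F @` S) \is a fin_num.
  by rewrite ge0_fin_numE ?measure_ge0// (le_lt_trans (H _ (leqnn _)))// ltry.
rewrite -(fineK fin); congr _%:E; apply/le_anti; rewrite fine_ge0 ?measure_ge0// andbT.
by apply: (@le0_of_dyadic_le _ _ (K ^+ d * 2 ^+ d * 2) 1) => N N1;
  have := H N N1; rewrite -[leLHS](fineK fin) lee_fin.
Qed.

End chart_measure.

(** * Change of variables *)

Section change_of_variables.
Context {R : realType} (d : nat).

Lemma open_sublevel_C11 (P : 'rV[R]_d -> R) (c : R) : C11 P ->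
  open [set x : 'rV[R]_d | `|x| < 2 /\ P x < c].
Proof.
move=> [g [M M0 HM]]; rewrite openE => x [x2 Pc]; rewrite /interior /=.
have cP : {for x, continuous (P : _ -> R^o)}.
  apply: (lipschitz_cvg M0 x2) => y y2.
  by have [] := HM x y x (ltW x2) y2 (ltW x2).
have N1 : \forall y \near x, P y < c by exact: (@cvgr_lt R _ (nbhs x) _ P (P x) cP).
have N2 : \forall y \near x, `|y| < 2.
  by apply: (@cvgr_norm_lt _ _ _ (nbhs x) _ id x) => //; exact: cvg_id.
by apply: filterS2 N1 N2 => y.
Qed.

Lemma closed_unit_cube : closed [set x : 'rV[R]_d | `|x| <= 1].
Proof.
rewrite (_ : mkset _ = closed_ball_ (@Num.norm R _) 0 1); first exact: closed_closed_ball_.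
by apply/seteqP; split => x /=; rewrite /closed_ball_ /= sub0r normrN.
Qed.

Lemma unit_cube_box : [set x : 'rV[R]_d | `|x| <= 1] = box (const_mx (-1)) (const_mx 1).
Proof.
have := box_cubeE (0 : 'rV[R]_d) (@ler01 R); rewrite sub0r add0r.
have -> : - const_mx 1 = const_mx (-1) :> 'rV[R]_d by apply/rowP => j; rewrite !mxE.
by move=> ->; apply/seteqP; split => x /=; rewrite subr0.
Qed.

Lemma compact_superlevel_C11 (P : 'rV[R]_d -> R) (c : R) : C11 P ->
  compact [set x : 'rV[R]_d | `|x| <= 1 /\ c <= P x].
Proof.
move=> CP; apply: (subclosed_compact _ (@compact_box R d (const_mx (-1)) (const_mx 1))).
  rewrite (_ : mkset _ = [set x : 'rV[R]_d | `|x| <= 1] `&` ~` [set x | `|x| < 2 /\ P x < c]).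
    apply: closedI; first exact: closed_unit_cube.
    by apply: open_closedC; exact: open_sublevel_C11.
  apply/seteqP; split => x /= [x1 cP]; split => //.
    by case=> _; rewrite ltNge cP.
  rewrite leNgt; apply/negP => Pc; apply: cP; split => //.
  by rewrite (le_lt_trans x1)// ltr1n.
by rewrite -unit_cube_box => x [].
Qed.

Variables (F : 'rV[R]_d -> 'rV[R]_d) (G : 'rV[R]_d -> 'M[R]_d) (K L : R).
Hypothesis FG : chart F G K L.

Let T := F @` [set x | `|x| <= 1].

Lemma measurable_chart_elt : measurable T.
Proof.
by apply: (measurable_chart_image FG) => //; rewrite unit_cube_box; exact: compact_box.
Qed.

(** The superlevel sets of f in the image are images of compact superlevel sets of
    P. *)
Lemma measurable_pullback (f P : 'rV[R]_d -> R) : C11 P ->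
  (forall x, `|x| <= 1 -> f (F x) = P x) -> measurable_fun T f.
Proof.
move=> CP fP mT; apply: (measurability _ (RGenCInfty.measurableE R)) => //.
move=> /= _ [_ [c ->] <-]; rewrite preimage_itvcy.
rewrite (_ : _ `&` _ = F @` [set x | `|x| <= 1 /\ c <= P x]).
  by apply: (measurable_chart_image FG) => [|x []//]; exact: compact_superlevel_C11.
apply/seteqP; split => y /=.
  by move=> [[x x1 <-]]; rewrite /= fP// => cP; exists x.
by move=> [x [x1 cP] <-]; split; [exists x|rewrite /= fP].
Qed.

Lemma leb_chart_elt_fin : (leb T < +oo)%E.
Proof.
have sub : T `<=` box (F 0 - const_mx K) (F 0 + const_mx K).
  rewrite box_cubeE ?(chart_K0 FG)// => _ [x /= x1 <-] /=.
  have [|||+ _] := @chart_C11 _ _ _ _ _ _ FG x 0 0; rewrite ?normr0 ?(le_trans x1) ?ler1n//.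
  move=> /le_trans; apply; rewrite subr0 -[leRHS]mulr1 ler_wpM2l// ?(chart_K0 FG)//.
apply: le_lt_trans (leb_le measurable_chart_elt _ sub) _; first exact: measurable_box.
rewrite leb_box ?ltry// => j; rewrite !mxE; have := chart_K0 FG; lra.
Qed.

Lemma chart_sub_elt (S : set 'rV[R]_d) : (forall x, S x -> `|x| <= 1) -> F @` S `<=` T.
Proof. by move=> S1; apply: image_subset => x /S1. Qed.

Lemma integrable_pullback (f P : 'rV[R]_d -> R) : C11 P ->
  (forall x, `|x| <= 1 -> f (F x) = P x) -> (@leb R d).-integrable T (EFin \o f).
Proof.
move=> CP fP; apply: measurable_bounded_integrable.
- exact: measurable_chart_elt.
- exact: leb_chart_elt_fin.
- exact: measurable_pullback CP fP.
have [g [M M0 HM]] := CP.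
exists M; split; first by rewrite num_real.
move=> e Me _ [x /= x1 <-] /=; rewrite fP//.
have x2 : `|x| <= 2 by rewrite (le_trans x1)// ler1n.
by have [h _ _ _] := HM x x x x2 x2 x2; exact: le_trans (ltW Me).
Qed.

Lemma norm_cube_le1 (x0 x : 'rV[R]_d) (r : R) : 0 <= r ->
  `|x0 - const_mx r| <= 1 -> `|x0 + const_mx r| <= 1 -> `|x - x0| <= r -> `|x| <= 1.
Proof.
move=> r0 a1 b1 xr; apply: (norm_between a1 b1).
by rewrite (box_cubeE _ r0).
Qed.

(** The image of the cube lies between two parallelepipeds with the same linear
    part, of relative sizes 1 - eta and 1 + eta. *)
Lemma leb_chart_cube (x0 : 'rV[R]_d) (r : R) : 0 <= r ->
  `|x0 - const_mx r| <= 1 -> `|x0 + const_mx r| <= 1 -> 2 * K * L * r <= 1 / 2 ->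
  `|fine (leb (F @` box (x0 - const_mx r) (x0 + const_mx r))) - `|\det (G x0)| * (2 * r) ^+ d|
    <= 3 ^+ d * (2 * K * L * r) * (`|\det (G x0)| * (2 * r) ^+ d).
Proof.
move=> r0 a1 b1 eta2.
set eta := 2 * K * L * r in eta2 *; set D := `|\det (G x0)|.
have eta0 : 0 <= eta by rewrite !mulr_ge0 ?(chart_K0 FG) ?(chart_L0 FG).
have x01 : `|x0| <= 1 by apply: (norm_cube_le1 r0 a1 b1); rewrite subrr normr0.
have [uG invG] := chart_inv FG x01.
have FA x y : `|x - x0| <= r -> `|y - x0| <= r ->
    `|F x - F y - (x - y) *m G x0| <= K * (`|x - x0| + `|y - x0|) * `|x - y|.
  move=> /(norm_cube_le1 r0 a1 b1)/norm_le2 x2 /(norm_cube_le1 r0 a1 b1)/norm_le2 y2.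
  by have [] := chart_C11 FG x2 y2 (norm_le2 x01).
have mQ := measurable_chart_box FG a1 b1.
have [mU lebU] := @leb_parallelepiped _ _ F _ x0 uG ((1 + eta) * r)
  (mulr_ge0 (addr_ge0 ler01 eta0) r0).
have e1 : 0 <= 1 - eta by lra.
have [mL lebL] := @leb_parallelepiped _ _ F _ x0 uG ((1 - eta) * r) (mulr_ge0 e1 r0).
have subU : F @` box (x0 - const_mx r) (x0 + const_mx r) `<=`
    parallelepiped F (G x0) x0 ((1 + eta) * r).
  rewrite (box_cubeE _ r0) => _ [x /= xr <-].
  exact: (image_sub_parallelepiped r0 (chart_K0 FG) (chart_L0 FG) uG invG FA).
have subL : parallelepiped F (G x0) x0 ((1 - eta) * r) `<=`
    F @` box (x0 - const_mx r) (x0 + const_mx r).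
  rewrite (box_cubeE _ r0) => y.
  move=> /(parallelepiped_sub_image r0 (chart_K0 FG) (chart_L0 FG) uG invG FA).
  have eta1 : eta < 1 by lra.
  by move=> /(_ eta1) [x xr <-]; exists x.
have := leb_le mL mQ subL; have := leb_le mQ mU subU; rewrite lebU lebL -/D.
have fin : leb (F @` box (x0 - const_mx r) (x0 + const_mx r)) \is a fin_num.
  by rewrite ge0_fin_numE ?measure_ge0// (le_lt_trans (leb_le mQ mU subU))// lebU ltry.
rewrite -(fineK fin) !lee_fin /=; move: (fine _) => m mle mge.
have D0 : 0 <= D by exact: normr_ge0.
have r20 : 0 <= 2 * r by rewrite mulr_ge0.
have V0 : 0 <= D * (2 * r) ^+ d by rewrite mulr_ge0 ?exprn_ge0.
have E t : D * (2 * ((1 + t) * r)) ^+ d = (1 + t) ^+ d * (D * (2 * r) ^+ d).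
  by rewrite mulrCA !exprMn; ring.
rewrite E in mle; rewrite (E (- eta)) in mge.
have eta01 : 0 <= eta <= 1 by apply/andP; split => //; lra.
have := ler_wpM2r V0 (expr1D_le d eta01); have := ler_wpM2r V0 (expr1B_ge d eta01).
rewrite ler_norml; move: (_ * _ ^+ d) mle mge => V; lra.
Qed.

(** Psi stands for the integral of P * D over boxes; all that is used is that it
    is additive and has the density P * D, with a uniform rate on cubes. The sign
    s of the determinant is constant on the cube. *)
Variables (P D : 'rV[R]_d -> R) (s : R) (Psi : 'rV[R]_d -> 'rV[R]_d -> R).
Hypothesis CP : C11 P.
Hypothesis CD : C11 D.
Hypothesis s1 : `|s| = 1.
Hypothesis detG : forall x, `|x| <= 1 -> `|\det (G x)| = s * D x.
Hypothesis Psi_split : forall a b j m, Psi a b = Psi a (set_entry b j m) + Psi (set_entry a j m) b.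
Hypothesis Psi_cube : exists2 M, 0 <= M & forall (x0 : 'rV[R]_d) r, 0 <= r ->
  `|x0 - const_mx r| <= 1 -> `|x0 + const_mx r| <= 1 ->
  `|Psi (x0 - const_mx r) (x0 + const_mx r) - P x0 * D x0 * (2 * r) ^+ d| <= M * r * (2 * r) ^+ d.

Lemma change_of_variables_cube (f : 'rV[R]_d -> R) :
  (forall x, `|x| <= 1 -> f (F x) = P x) ->
  exists2 M, 0 <= M & forall (x0 : 'rV[R]_d) r, 0 <= r ->
  `|x0 - const_mx r| <= 1 -> `|x0 + const_mx r| <= 1 -> 2 * K * L * r <= 1 / 2 ->
  `|\int[@leb R d]_(y in F @` box (x0 - const_mx r) (x0 + const_mx r)) f y -
    s * Psi (x0 - const_mx r) (x0 + const_mx r)| <= M * r * (2 * r) ^+ d.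
Proof.
move=> fP; have [gP [MP MP0 HP]] := CP; have [gD [MD MD0 HD]] := CD.
have [MPsi MPsi0 HPsi] := Psi_cube.
exists (MP * MD * (1 + 3 ^+ d) + MP * (3 ^+ d * (2 * K * L)) * MD + MPsi).
  by rewrite !addr_ge0 ?mulr_ge0 ?addr_ge0 ?exprn_ge0 ?(chart_K0 FG) ?(chart_L0 FG).
move=> x0 r r0 a1 b1 eta2.
have x01 : `|x0| <= 1 by apply: (norm_cube_le1 r0 a1 b1); rewrite subrr normr0.
have mQ := measurable_chart_box FG a1 b1.
have := leb_chart_cube r0 a1 b1 eta2; have := HPsi x0 r r0 a1 b1.
rewrite detG//.
set B := F @` _ in mQ *; set V := (2 * r) ^+ d; set m := fine _.
have m0 : 0 <= m by rewrite fine_ge0 ?measure_ge0.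
have [Px0 _ _ _] := HP _ _ _ (norm_le2 x01) (norm_le2 x01) (norm_le2 x01).
have [Dx0 _ _ _] := HD _ _ _ (norm_le2 x01) (norm_le2 x01) (norm_le2 x01).
have sub : B `<=` T.
  by apply: chart_sub_elt => x; rewrite (box_cubeE _ r0) => /(norm_cube_le1 r0 a1 b1).
have ints (g Q : 'rV[R]_d -> R) : C11 Q -> (forall x, `|x| <= 1 -> g (F x) = Q x) ->
    (@leb R d).-integrable B (EFin \o g).
  move=> CQ gQ; apply: integrableS (integrable_pullback CQ gQ) => //.
  exact: measurable_chart_elt.
have fi := ints _ _ CP fP.
have ci (c : R) := ints (fun=> c) (fun=> c) (C11_cst _ c) (fun _ _ => erefl).
have fci (c : R) : (@leb R d).-integrable B (EFin \o (fun y => f y - c)).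
  by apply: (ints _ (fun x => P x + - c)) => [|x x1]; [exact: (C11D CP (C11_cst _ _))|rewrite fP].
have intf : `|\int[@leb R d]_(y in B) f y - P x0 * m| <= MP * r * m.
  rewrite -Rintegral_cst// -RintegralB//.
  apply: le_trans (le_normr_Rintegral _ _) _ => //.
  rewrite -[leRHS]Rintegral_cst//; apply: le_Rintegral => //.
    exact: (integrable_norm (fci _)).
  move=> _ [x xB <-]; move: xB; rewrite (box_cubeE _ r0) => /= xr.
  have x1 := norm_cube_le1 r0 a1 b1 xr; rewrite fP//.
  have [_ + _ _] := HP _ _ _ (norm_le2 x1) (norm_le2 x01) (norm_le2 x01).
  by move=> /le_trans; apply; rewrite ler_wpM2l.
have A0 : 0 <= s * D x0 by rewrite -detG.
have AM : s * D x0 <= MD by rewrite -[leLHS](ger0_norm A0) normrM s1 mul1r.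
have V0 : 0 <= V by rewrite exprn_ge0 ?mulr_ge0.
have C0 : 0 <= 3 ^+ d :> R by rewrite exprn_ge0.
have KL0 : 0 <= 2 * K * L by rewrite !mulr_ge0 ?(chart_K0 FG) ?(chart_L0 FG).
move: (\int[_]_(y in _) f y) (Psi _ _) intf => If Ip Ifm Ipm mD.
set A := s * D x0 in A0 AM mD *.
have mV : m <= MD * V * (1 + 3 ^+ d).
  have : m <= A * V * (1 + 3 ^+ d).
    have /ler_normlP[_ h] := mD.
    have := ler_wpM2l (mulr_ge0 C0 (mulr_ge0 A0 V0)) (le_trans eta2 _ : 2 * K * L * r <= 1).
    have h1 : 1 / 2 <= 1 :> R by lra.
    move=> /(_ h1); move: h; lra.
  move=> /le_trans; apply; rewrite ler_wpM2r ?addr_ge0// ler_wpM2r//.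
have -> : If - s * Ip = (If - P x0 * m) + P x0 * (m - A * V) - s * (Ip - P x0 * D x0 * V).
  by rewrite /A; ring.
apply: le_trans (ler_normB _ _) _; rewrite normrM s1 mul1r.
apply: le_trans (lerD (ler_normD _ _) Ipm) _; rewrite [`|P x0 * _|]normrM.
have B1 : MP * r * m <= MP * r * (MD * V * (1 + 3 ^+ d)) by rewrite ler_wpM2l ?mulr_ge0.
have B2 : `|P x0| * `|m - A * V| <= MP * (3 ^+ d * (2 * K * L * r) * (MD * V)).
  rewrite ler_pM//; apply: le_trans mD _.
  by rewrite ler_wpM2l ?(mulr_ge0 C0 (mulr_ge0 KL0 r0))// ler_wpM2r.
apply: le_trans (lerD (lerD (le_trans Ifm B1) B2) (lexx _)) _.
by rewrite le_eqVlt; apply/orP; left; apply/eqP; ring.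
Qed.

(** Both sides are additive on boxes, because images of faces are null, and they
    agree up to a relative error O(r) on cubes of radius r; summing over dyadic
    subdivisions, the error on the whole cube tends to 0. *)
Lemma change_of_variables (f : 'rV[R]_d -> R) :
  (forall x, `|x| <= 1 -> f (F x) = P x) ->
  \int[@leb R d]_(y in T) f y = s * Psi (const_mx (-1)) (const_mx 1).
Proof.
move=> fP; have [M M0 HM] := change_of_variables_cube fP.
pose Phi a b := \int[@leb R d]_(y in F @` box a b) f y - s * Psi a b.
suff : `|Phi (const_mx (-1)) (const_mx 1)| <= 0.
  by rewrite normr_le0 subr_eq0 => /eqP; rewrite /T unit_cube_box.
have [N0 HN0] : exists N0 : nat, forall N, (N0 <= N)%N -> 2 * K * L * (1 / 2 ^+ N) <= 1 / 2.
  have KL0 : 0 <= 4 * K * L by rewrite !mulr_ge0 ?(chart_K0 FG) ?(chart_L0 FG).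
  exists (Num.bound (4 * K * L)) => N NN0.
  have h : 4 * K * L <= 2 ^+ N.
    apply: (le_trans (ltW (archi_boundP KL0))); apply: (@le_trans _ _ N%:R).
      by rewrite ler_nat.
    by rewrite -natrX ler_nat ltnW// ltn_expl.
  rewrite mulrA ler_pdivrMr ?exprn_gt0//; lra.
apply: (@le0_of_dyadic_le _ _ (M * 2 ^+ d) N0) => N NN0.
pose h : R := 2 / 2 ^+ N; pose r := h / 2.
have h0 : 0 < h by rewrite divr_gt0 ?exprn_gt0.
have r0 : 0 <= r by rewrite divr_ge0 ?(ltW h0).
have rE : r = 1 / 2 ^+ N by rewrite /r /h; field; rewrite expf_neq0.
have volE : vol (const_mx (-1) : 'rV[R]_d) (const_mx 1) = 2 ^+ d.
  rewrite /vol (eq_bigr (fun=> 2)) ?prodr_const ?card_ord// => j _.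
  by rewrite !mxE; ring.
have -> : M * 2 ^+ d / 2 ^+ N = M * r * vol (const_mx (-1) : 'rV[R]_d) (const_mx 1).
  by rewrite volE rE; ring.
apply: (@dyadic_ind _ _ (fun a b => `|Phi a b| <= M * r * vol a b) h h0 _ _ (fun=> N)).
- move=> a; pose x0 := a + const_mx r.
  have -> : a + const_mx h = x0 + const_mx r.
    by apply/rowP => j; rewrite !mxE /r; field.
  have -> : a = x0 - const_mx r by rewrite addrK.
  move=> a1 b1; have -> : vol (x0 - const_mx r) (x0 + const_mx r) = (2 * r) ^+ d.
    rewrite /vol (eq_bigr (fun=> 2 * r)) ?prodr_const ?card_ord// => j _.
    by rewrite !mxE; ring.
  by apply: HM => //; rewrite rE; exact: HN0.
- move=> a b j m a1 b1 ab am.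
  have [am1 bm1] := set_entry_norm a1 b1 ab am.
  suff -> : Phi a b = Phi a (set_entry b j m) + Phi (set_entry a j m) b.
    rewrite (vol_split a b j m) mulrDr => H1 H2.
    exact: le_trans (ler_normD _ _) (lerD H1 H2).
  have m1 : `|m| <= 1.
    by have := ler_entry_norm (set_entry a j m) j; rewrite set_entryE => /le_trans; exact.
  have mA := measurable_chart_box FG a1 bm1; have mB := measurable_chart_box FG am1 b1.
  rewrite /Phi (Psi_split a b j m) (box_split am) image_setU Rintegral_setU_null//.
  + by rewrite mulrDr opprD addrACA.
  + apply/le_anti; rewrite measure_ge0 andbT -(leb_chart_face FG j m1).
    apply: leb_le; [exact: measurableI|exact: (measurable_chart_face FG)|].
    move=> _ [[x xA <-] [x' xB /(chart_inj FG)]].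
    have x1 := norm_between a1 bm1 xA; have x1' := norm_between am1 b1 xB.
    move=> /(_ x1' x1) E; rewrite E in xB; exists x => //; split => //.
    exact: (@box_split_cap _ _ a b).
  + apply: integrableS (integrable_pullback CP fP).
    * exact: measurable_chart_elt.
    * exact: measurableU.
    * rewrite -image_setU -(box_split am); apply: chart_sub_elt => x; exact: norm_between.
- by apply: rV_norm_le => // j; rewrite mxE normrN normr1.
- by apply: rV_norm_le => // j; rewrite mxE normr1.
- by move=> j; rewrite !mxE /h mulrVK ?unitfE ?expf_neq0//; lra.
Qed.

End change_of_variables.

(** * Integrals of univariate polynomials *)

Section primitive.
Context {R : realType}.
Implicit Types p q : {poly R}.

Definition prim p : {poly R} := \poly_(i < (size p).+1) (p`_i.-1 / i%:R).

Lemma coef_prim p i : (prim p)`_i = p`_i.-1 / i%:R.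
Proof.
rewrite coef_poly; case: ltnP => //; case: i => [//|i]; rewrite ltnS => pi.
by rewrite nth_default// mul0r.
Qed.

Lemma deriv_prim p : (prim p)^`() = p.
Proof.
apply/polyP => i; rewrite coef_deriv coef_prim /= -[LHS]mulr_natr mulfVK//.
Qed.

Lemma prim_deriv p : prim p^`() = p - (p`_0)%:P.
Proof.
apply/polyP => -[|i]; rewrite coef_prim coefB coefC /=; first by rewrite invr0 mulr0 subrr.
by rewrite subr0 coef_deriv -[p`_i.+1 *+ _]mulr_natr mulfK// pnatr_eq0.
Qed.

(** An antiderivative rather than an integral, so that additivity in the end
    points holds whatever their order. *)
Definition poly_int p (a b : R) := (prim p).[b] - (prim p).[a].

Lemma poly_int_deriv p a b : poly_int p^`() a b = p.[b] - p.[a].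
Proof. by rewrite /poly_int prim_deriv !hornerE; ring. Qed.

Lemma poly_intD p q a b : poly_int (p + q) a b = poly_int p a b + poly_int q a b.
Proof.
have -> : poly_int (p + q) a b = poly_int (prim p + prim q)^`() a b.
  by rewrite derivD !deriv_prim.
by rewrite poly_int_deriv !hornerD /poly_int; ring.
Qed.

Lemma poly_intZ c p a b : poly_int (c *: p) a b = c * poly_int p a b.
Proof.
have -> : poly_int (c *: p) a b = poly_int (c *: prim p)^`() a b.
  by rewrite derivZ !deriv_prim.
by rewrite poly_int_deriv !hornerE /poly_int; ring.
Qed.

Lemma poly_int0 a b : poly_int 0 a b = 0.
Proof. by rewrite -(scale0r 0) poly_intZ mul0r. Qed.

Lemma poly_int_sum (J : Type) (s : seq J) (f : J -> {poly R}) a b :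
  poly_int (\sum_(i <- s) f i) a b = \sum_(i <- s) poly_int (f i) a b.
Proof.
elim: s => [|i s IHs]; first by rewrite !big_nil poly_int0.
by rewrite !big_cons poly_intD IHs.
Qed.

Lemma poly_int_parts p q a b :
  poly_int (p * q^`()) a b = p.[b] * q.[b] - p.[a] * q.[a] - poly_int (p^`() * q) a b.
Proof.
have := poly_int_deriv (p * q) a b; rewrite derivM poly_intD !hornerM => <-; ring.
Qed.

Lemma poly_int_mean p a b : a <= b -> exists2 c, a <= c <= b & poly_int p a b = p.[c] * (b - a).
Proof.
rewrite le_eqVlt => /predU1P[->|ab].
  by exists b; rewrite ?lexx// /poly_int !subrr mulr0.
have [c cab E] := poly_mvt (prim p) ab; exists c.
  by rewrite !ltW// (itvP cab).
by rewrite /poly_int E deriv_prim.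
Qed.

Lemma poly_int_ge0 p a b : a <= b -> (forall t, a <= t <= b -> 0 <= p.[t]) ->
  0 <= poly_int p a b.
Proof.
by move=> ab p0; have [c /p0 pc ->] := poly_int_mean p ab; rewrite mulr_ge0// subr_ge0.
Qed.

(** The primitive of p is monotone; equal values at both ends would make it
    constant. *)
Lemma poly_int_gt0 p a b : a < b -> (forall t, a <= t <= b -> 0 <= p.[t]) -> p != 0 ->
  0 < poly_int p a b.
Proof.
move=> ab p0 pn0; rewrite lt_def poly_int_ge0 ?(ltW ab)// andbT.
apply: contra_neq pn0 => pab.
(* Every point of the interval is a zero of the primitive minus its value at a. *)
have cst t : a <= t <= b -> root (prim p - (prim p).[a]%:P) t.
  move=> /andP[at_ tb]; rewrite rootE !hornerE subr_eq0; apply/eqP/le_anti.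
  have h1 : 0 <= poly_int p a t.
    by apply: poly_int_ge0 => // s /andP[? st]; apply: p0; apply/andP; split; lra.
  have h2 : 0 <= poly_int p t b.
    by apply: poly_int_ge0 => // s /andP[? st]; apply: p0; apply/andP; split; lra.
  move: pab h1 h2.
  by rewrite /poly_int => ? ? ?; apply/andP; split; lra.
have : prim p - (prim p).[a]%:P = 0.
  pose N := size (prim p - (prim p).[a]%:P).
  apply: (@roots_geq_poly_eq0 _ _ [seq a + (b - a) / i.+1%:R | i <- iota 0 N]).
  - apply/allP => _ /mapP[i _ ->]; apply: cst.
    have h : 0 <= (b - a) / i.+1%:R <= b - a.
      have ab0 : 0 <= b - a by rewrite subr_ge0 ltW.
      by rewrite divr_ge0//= ler_pdivrMr// ler_peMr// ler1n.
    by move: h => /andP[h1 h2]; rewrite lerDl h1 -lerBrDl.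
  - rewrite map_inj_uniq ?iota_uniq// => i j /addrI/(mulfI _).
    by rewrite subr_eq0 gt_eqF// => /(_ isT)/invr_inj/eqP; rewrite eqr_nat => /eqP[].
  - by rewrite size_map size_iota.
by move=> /(congr1 (@deriv R)); rewrite derivB deriv_prim derivC subr0 deriv0.
Qed.

Lemma Rintegral_horner p a b : a < b ->
  \int[@lebesgue_measure R]_(t in `[a, b]) p.[t] = poly_int p a b.
Proof.
move=> ab; rewrite /Rintegral (@continuous_FTC2 _ (horner p) (horner (prim p)))//.
- apply: continuous_subspaceT => x; exact: continuous_horner.
- split=> [x _| |]; first exact: derivable_horner.
  + by apply: cvg_at_right_filter; exact: continuous_horner.
  + by apply: cvg_at_left_filter; exact: continuous_horner.
- by move=> x _; rewrite -derivE deriv_prim.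
Qed.

End primitive.

(** * Gauss-Legendre quadrature *)

Section legendre.
Context {R : realType}.

(** Each derivative lowers the multiplicity of the root c by at most one. *)
Lemma derivn_XsubC_exp (c : R) k n q : exists r : {poly R},
  ((('X - c%:P) ^+ (n + k)) * q)^`(k) = ('X - c%:P) ^+ n * r.
Proof.
elim: k n q => [|k IHk] n q; first by exists q; rewrite addn0 derivn0.
have [r Hr] := IHk n.+1 q; exists (r *+ n.+1 + ('X - c%:P) * r^`()).
rewrite derivnS addnS -addSn Hr derivM deriv_exp derivXsubC mul1r /= mulrDr.
by rewrite mulrnAl mulrnAr exprSr mulrA.
Qed.

(** The polynomial whose n-th derivative is, up to a scalar, the Legendre
    polynomial. *)
Definition rodrigues n : {poly R} := ('X^2 - 1) ^+ n.

Lemma rodriguesE n : rodrigues n = ('X - 1%:P) ^+ n * ('X - (-1)%:P) ^+ n.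
Proof. by rewrite /rodrigues -exprMn; congr (_ ^+ n); rewrite polyCN; ring. Qed.

Lemma rodrigues_boundary n k : (k < n)%N ->
  (rodrigues n)^`(k).[1] = 0 /\ (rodrigues n)^`(k).[-1] = 0.
Proof.
move=> kn; have nE : n = ((n - k) + k)%N by rewrite subnK// ltnW.
have nk : (0 < n - k)%N by rewrite subn_gt0.
have root0 (c : R) r : (('X - c%:P) ^+ (n - k) * r).[c] = 0.
  by rewrite hornerM horner_exp hornerXsubC subrr expr0n gtn_eqF// mul0r.
split; rewrite rodriguesE.
  by rewrite {1}nE; have [r ->] := derivn_XsubC_exp 1 k (n - k) (('X - (-1)%:P) ^+ n).
by rewrite mulrC {1}nE; have [r ->] := derivn_XsubC_exp (-1) k (n - k) (('X - 1%:P) ^+ n).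
Qed.

(** The boundary terms of each integration by parts vanish by
    rodrigues_boundary. *)
Lemma rodrigues_parts n m q : (m <= n)%N ->
  poly_int (q * (rodrigues n)^`(m)) (-1) 1 = (-1) ^+ m * poly_int (q^`(m) * rodrigues n) (-1) 1.
Proof.
elim: m q => [|m IHm] q mn; first by rewrite expr0 mul1r !derivn0.
have [b1 b2] := rodrigues_boundary mn.
rewrite derivnS poly_int_parts b1 b2 !mulr0 subrr sub0r IHm ?(ltnW mn)//.
by rewrite exprS mulN1r mulNr derivSn.
Qed.

Lemma size_rodrigues n : size (rodrigues n) = n.*2.+1.
Proof.
have X0 : 'X^2 - 1 != 0 :> {poly R} by rewrite -polyC1 monic_neq0// monicXnsubC.
rewrite -(@prednK (size (rodrigues n))) ?size_poly_gt0 ?expf_neq0//.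
by rewrite /rodrigues size_exp -polyC1 size_XnsubC// mul2n.
Qed.

Lemma size_legendre n : size (legendre n : {poly R}) = n.+1.
Proof.
have L0 : (2 ^+ n * n`!%:R)^-1 != 0 :> R.
  by rewrite invr_eq0 mulf_neq0 ?expf_neq0 ?pnatr_eq0// -lt0n fact_gt0.
rewrite /legendre size_scale// -/(rodrigues n); apply/anti_leq/andP; split.
  apply/leq_sizeP => j nj; rewrite coef_derivn nth_default ?mul0rn//.
  by rewrite size_rodrigues -addnn -addnS leq_add2l.
rewrite ltnNge; apply/negP => /leq_sizeP/(_ n (leqnn n))/eqP.
rewrite coef_derivn mulrn_eq0 gtn_eqF ?ffact_gt0 ?leq_addr//= addnn.
have -> : n.*2 = (size (rodrigues n)).-1 by rewrite size_rodrigues.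
by rewrite -lead_coefE lead_coef_eq0 -size_poly_eq0 size_rodrigues.
Qed.

(** After n integrations by parts all derivatives bear on q, whose degree is less
    than n. *)
Lemma legendre_orthogonal n (q : {poly R}) : 
  (size q <= n)%N -> poly_int (q * legendre n) (-1) 1 = 0.
Proof.
move=> qn; rewrite /legendre -scalerAr poly_intZ -/(rodrigues n) rodrigues_parts//.
by rewrite derivn_poly0// mul0r poly_int0 !mulr0.
Qed.

End legendre.

Section gauss_quadrature.
Context {R : realType} (n : nat) (xi : 'I_n -> R).
Hypothesis hxi : gauss_nodes xi.

Let xi_inj : injective xi. Proof. by case: hxi. Qed.

Definition lagrange_basis (k : 'I_n) : {poly R} :=
  \prod_(l | l != k) ((xi k - xi l)^-1 *: ('X - (xi l)%:P)).

Lemma lagrange_basisE k l : (lagrange_basis k).[xi l] = (l == k)%:R.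
Proof.
rewrite horner_prod; have [->|lk] := eqVneq l k.
  rewrite big1// => j jk; rewrite hornerZ hornerXsubC mulVf// subr_eq0.
  by rewrite (inj_eq xi_inj) eq_sym.
by rewrite (bigD1 l)//= hornerZ hornerXsubC subrr mulr0 mul0r.
Qed.

Lemma lagrange_basis_neq0 k : lagrange_basis k != 0.
Proof.
apply/eqP => l0; have := lagrange_basisE k k; rewrite l0 horner0 eqxx => /eqP.
by rewrite eq_sym oner_eq0.
Qed.

Lemma size_lagrange_basis k : (size (lagrange_basis k) <= n)%N.
Proof.
apply: leq_trans (size_poly_prod_leq _ _) _.
have cP : #|[pred l | l != k]| = n.-1 by rewrite cardC1 card_ord.
have n0 : (0 < n)%N by exact: leq_ltn_trans (ltn_ord k).
rewrite leq_subLR cP -[X in (_ <= _ + X)%N](prednK n0) addnS ltnS addnn -muln2 -cP.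
rewrite -sum_nat_const; apply: leq_sum => l _.
by apply: leq_trans (size_scale_leq _ _) _; rewrite size_XsubC.
Qed.

Lemma gauss_weightE k : gauss_weight xi k = poly_int (lagrange_basis k) (-1) 1.
Proof.
have lt11 : -1 < 1 :> R by lra.
rewrite -(Rintegral_horner _ lt11).
apply: eq_Rintegral => t _; rewrite horner_prod; apply: eq_bigr => l _.
by rewrite hornerZ hornerXsubC mulrC.
Qed.

Lemma lagrange_interpolation (r : {poly R}) : (size r <= n)%N ->
  r = \sum_k r.[xi k] *: lagrange_basis k.
Proof.
move=> rn; apply/eqP; rewrite -subr_eq0; apply/eqP.
apply: (@roots_geq_poly_eq0 _ _ (codom xi)).
- apply/allP => _ /codomP[k ->]; rewrite rootE !hornerE horner_sum (bigD1 k)//=.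
  rewrite hornerZ lagrange_basisE eqxx mulr1 big1 ?addr0 ?subrr// => j jk.
  by rewrite hornerZ lagrange_basisE eq_sym (negbTE jk) mulr0.
- by rewrite map_inj_uniq ?enum_uniq.
rewrite size_codom card_ord; apply: leq_trans (size_polyD _ _) _.
rewrite size_polyN geq_max rn; apply: leq_trans (size_sum _ _ _) _.
apply/bigmax_leqP => k _; apply: leq_trans (size_scale_leq _ _) _.
exact: size_lagrange_basis.
Qed.

(** Divide by the Legendre polynomial L: the quotient has degree less than n, so
    its product with L has integral 0, and the remainder, which has the nodal
    values of u, is integrated exactly by Lagrange interpolation. *)
Lemma gauss_exact (u : {poly R}) : (size u <= n.*2)%N ->
  poly_int u (-1) 1 = \sum_k gauss_weight xi k * u.[xi k].
Proof.
move=> un; set L : {poly R} := legendre n.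
have sL : size L = n.+1 by exact: size_legendre.
have L0 : L != 0 by rewrite -size_poly_eq0 sL.
have rn : (size (u %% L)%R <= n)%N by rewrite -ltnS -sL ltn_modp.
rewrite {1}(divp_eq u L) poly_intD legendre_orthogonal ?add0r; last first.
  by rewrite size_divp// sL /= leq_subLR addnn.
rewrite {1}(lagrange_interpolation rn) poly_int_sum; apply: eq_bigr => k _.
rewrite poly_intZ -gauss_weightE mulrC {2}(divp_eq u L) hornerD hornerM.
have /eqP -> : root L (xi k) by case: hxi.
by rewrite mulr0 add0r.
Qed.

(** The weight is the integral of the square of its Lagrange basis polynomial, as
    the rule is exact in degree 2 n - 2. *)
Lemma gauss_weight_gt0 k : 0 < gauss_weight xi k.
Proof.
have n0 : (0 < n)%N by exact: leq_ltn_trans (ltn_ord k).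
pose u := lagrange_basis k * lagrange_basis k.
have u0 := lagrange_basis_neq0 k.
have un : (size u <= n.*2)%N.
  apply: leq_trans (size_polyMleq _ _) _; rewrite -addnn.
  apply: leq_trans (leq_pred _) _; exact: leq_add (size_lagrange_basis _) (size_lagrange_basis _).
have := gauss_exact un; rewrite (bigD1 k)//= big1 ?addr0; last first.
  by move=> l lk; rewrite hornerM lagrange_basisE (negbTE lk) !mulr0.
rewrite hornerM lagrange_basisE eqxx !mulr1 => <-; apply: poly_int_gt0; first by lra.
  by move=> t _; rewrite hornerM -expr2 sqr_ge0.
by rewrite mulf_neq0.
Qed.

(** The rule integrates l_k(t)^2 (t - xi_k) exactly, to the value 0; were xi_k
    outside the open interval, the integrand would have a constant sign. *)
Lemma gauss_node_itv k : -1 < xi k < 1.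
Proof.
have n0 : (0 < n)%N by exact: leq_ltn_trans (ltn_ord k).
pose u := lagrange_basis k * lagrange_basis k.
have u0 := lagrange_basis_neq0 k.
have un : (size u <= n.*2.-1)%N.
  apply: leq_trans (size_polyMleq _ _) _; rewrite -addnn.
  by rewrite -!subn1 leq_sub2r// leq_add// size_lagrange_basis.
pose v := u * ('X - (xi k)%:P).
have v0 : v != 0 by rewrite !mulf_neq0// polyXsubC_eq0.
have vn : (size v <= n.*2)%N.
  apply: leq_trans (size_polyMleq _ _) _; rewrite size_XsubC addn2 /=.
  by rewrite -(@prednK n.*2) ?double_gt0.
have := gauss_exact vn; rewrite big1; last first.
  move=> l _; rewrite !hornerM hornerXsubC lagrange_basisE; have [->|] := eqVneq l k.
    by rewrite subrr !mulr0.
  by rewrite mul0r mul0r mulr0.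
have lt11 : -1 < 1 :> R by lra.
have vE t : v.[t] = (lagrange_basis k).[t] ^+ 2 * (t - xi k).
  by rewrite !hornerM hornerXsubC expr2.
move=> vI; rewrite !ltNge -negb_or; apply/negP => /orP[xi1|xi1].
- suff : 0 < poly_int v (-1) 1 by rewrite vI ltxx.
  apply: poly_int_gt0 => // t /andP[t1 _]; rewrite vE mulr_ge0 ?sqr_ge0// subr_ge0.
  exact: le_trans t1.
- suff : 0 < poly_int (-1 *: v) (-1) 1 by rewrite poly_intZ vI mulr0 ltxx.
  apply: poly_int_gt0 => // [t /andP[_ t1]|].
    2: by rewrite scaler_eq0 negb_or v0 oppr_eq0 oner_eq0.
  rewrite hornerZ vE mulN1r -mulrN opprB mulr_ge0 ?sqr_ge0// subr_ge0.
  exact: le_trans xi1.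
Qed.

End gauss_quadrature.

(** * Tensor product quadrature *)

Section separable.
Context {R : realType} (d : nat) (J : finType) (c : J -> R) (u : J -> 'I_d -> {poly R}).

Definition sep_poly (x : 'rV[R]_d) : R := \sum_i c i * \prod_j (u i j).[x 0 j].

(** The integral of sep_poly over the box from a to b. *)
Definition sep_int (a b : 'rV[R]_d) : R :=
  \sum_i c i * \prod_j poly_int (u i j) (a 0 j) (b 0 j).

Lemma sep_int_split (a b : 'rV[R]_d) j m :
  sep_int a b = sep_int a (set_entry b j m) + sep_int (set_entry a j m) b.
Proof.
rewrite /sep_int -big_split /=; apply: eq_bigr => i _; rewrite -mulrDr; congr (_ * _).
rewrite !(bigD1 j (P := xpredT))//= !set_entryE.
rewrite [X in _ = _ * X + _](eq_bigr (fun k => poly_int (u i k) (a 0 k) (b 0 k))); last first.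
  by move=> k kj; rewrite set_entry_neq.
rewrite [X in _ = _ + _ * X](eq_bigr (fun k => poly_int (u i k) (a 0 k) (b 0 k))); last first.
  by move=> k kj; rewrite set_entry_neq.
by rewrite /poly_int; ring.
Qed.

Lemma sep_int_cube : exists2 M, 0 <= M & forall (x0 : 'rV[R]_d) r, 0 <= r ->
  `|x0 - const_mx r| <= 1 -> `|x0 + const_mx r| <= 1 ->
  `|sep_int (x0 - const_mx r) (x0 + const_mx r) - sep_poly x0 * (2 * r) ^+ d|
    <= M * r * (2 * r) ^+ d.
Proof.
have /choice[M HM] : forall i, exists Mi : R, 0 <= Mi /\
    forall x y : 'rV[R]_d, `|x| <= 1 -> `|y| <= 1 ->
    `|\prod_j (u i j).[x 0 j] - \prod_j (u i j).[y 0 j]| <= Mi * `|x - y|.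
  move=> i; have : C11 (fun x : 'rV[R]_d => \prod_j (u i j).[x 0 j]).
    by apply: C11_prod => j; exact: C11_horner.
  move=> [g [Mi Mi0 H]]; exists Mi; split => // x y x1 y1.
  by have [] := H x y y (norm_le2 x1) (norm_le2 y1) (norm_le2 y1).
exists (\sum_i `|c i| * M i).
  by apply: sumr_ge0 => i _; rewrite mulr_ge0//; have [] := HM i.
move=> x0 r r0 a1 b1; rewrite /sep_int /sep_poly !mulr_suml -sumrB.
apply: le_trans (ler_norm_sum _ _ _) _; apply: ler_sum => i _.
have [M0 HMi] := HM i.
have V0 : 0 <= (2 * r) ^+ d by rewrite exprn_ge0// mulr_ge0.
(* The mean value theorem in each factor gives one point of the cube at which
   the monomial takes its mean value. *)
have /choice[z Hz] : forall j, exists t, (x0 - const_mx r) 0 j <= t <= (x0 + const_mx r) 0 j /\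
    poly_int (u i j) ((x0 - const_mx r) 0 j) ((x0 + const_mx r) 0 j) = (u i j).[t] * (2 * r).
  move=> j; have [|t tab tE] := @poly_int_mean _ (u i j)
    ((x0 - const_mx r) 0 j) ((x0 + const_mx r) 0 j).
    by rewrite !mxE; lra.
  exists t; split => //; rewrite tE; congr (_ * _); rewrite !mxE; ring.
pose y : 'rV[R]_d := \row_j z j.
have yx0 : `|y - x0| <= r.
  have : box (x0 - const_mx r) (x0 + const_mx r) y by move=> j; rewrite [y 0 j]mxE; have [] := Hz j.
  by rewrite (box_cubeE _ r0).
have y1 := norm_cube_le1 r0 a1 b1 yx0.
have x01 : `|x0| <= 1 by apply: (norm_cube_le1 r0 a1 b1); rewrite subrr normr0.
have -> : \prod_j poly_int (u i j) ((x0 - const_mx r) 0 j) ((x0 + const_mx r) 0 j) =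
    \prod_j (u i j).[y 0 j] * (2 * r) ^+ d.
  rewrite -[X in _ ^+ X]card_ord -prodr_const -big_split /=; apply: eq_bigr => j _.
  by rewrite [y 0 j]mxE; have [] := Hz j.
rewrite mulrA -mulrBl -mulrBr !normrM (ger0_norm V0) ler_wpM2r// -mulrA ler_wpM2l//.
by apply: le_trans (HMi _ _ y1 x01) _; rewrite ler_wpM2l.
Qed.

Lemma sep_int_gauss n (xi : 'I_n -> R) : gauss_nodes xi ->
  (forall i j, (size (u i j) <= n.*2)%N) ->
  sep_int (const_mx (-1)) (const_mx 1) =
  \sum_(k : {ffun 'I_d -> 'I_n}) tensor_weight xi k * sep_poly (gauss_point xi k).
Proof.
move=> hxi un; under [RHS]eq_bigr do rewrite mulr_sumr.
rewrite exchange_big /sep_int /=; apply: eq_bigr => i _.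
under eq_bigr do rewrite !mxE (gauss_exact hxi (un i _)).
rewrite bigA_distr_bigA mulr_sumr; apply: eq_bigr => k _.
rewrite mulrCA; congr (_ * _); rewrite /tensor_weight -big_split /=.
by apply: eq_bigr => j _; rewrite mxE.
Qed.

End separable.

Section tensor_products.
Context {R : realType} (d : nat).

(** In the quadrature, the three factors are two discrete functions and the
    Jacobian determinant; the degrees in each variable add up. *)
Lemma tensor_poly3 r1 r2 r3 (c1 : {ffun 'I_d -> 'I_r1.+1} -> R)
    (c2 : {ffun 'I_d -> 'I_r2.+1} -> R) (c3 : {ffun 'I_d -> 'I_r3.+1} -> R) (x : 'rV[R]_d) :
  tensor_poly c1 x * tensor_poly c2 x * tensor_poly c3 x =
  sep_poly (fun a : ({ffun 'I_d -> 'I_r1.+1} * {ffun 'I_d -> 'I_r2.+1}) * {ffun 'I_d -> 'I_r3.+1} =>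
      c1 a.1.1 * c2 a.1.2 * c3 a.2)
    (fun a j => 'X^(a.1.1 j + a.1.2 j + a.2 j)) x.
Proof.
rewrite /tensor_poly /sep_poly big_distrlr pair_bigA big_distrlr pair_bigA /=.
apply: eq_bigr => -[[a1 a2] a3] _ /=.
under [X in _ = _ * X]eq_bigr do rewrite hornerXn !exprD.
by rewrite !big_split /=; ring.
Qed.

Lemma tensor_poly_sign r (c : {ffun 'I_d -> 'I_r.+1} -> R) :
  (forall x, `|x| <= 1 -> tensor_poly c x != 0) ->
  exists s : R, `|s| = 1 /\ forall x, `|x| <= 1 -> `|tensor_poly c x| = s * tensor_poly c x.
Proof.
move=> c0; pose s := Num.sg (tensor_poly c 0).
have s1 : `|s| = 1 by rewrite normr_sg c0 ?normr0.
exists s; split => // x x1; rewrite [LHS]normrEsg; congr (_ * _).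
apply/eqP; apply: contraT => sx.
(* Otherwise the restriction to the segment from 0 to x has a zero. *)
pose P : {poly R} := \sum_(a : {ffun 'I_d -> 'I_r.+1}) c a *: \prod_j ((x 0 j) *: 'X) ^+ a j.
have PE t : P.[t] = tensor_poly c (t *: x).
  rewrite /P horner_sum; apply: eq_bigr => a _; rewrite hornerZ horner_prod; congr (_ * _).
  by apply: eq_bigr => j _; rewrite horner_exp !hornerE mxE mulrC.
have n0 : tensor_poly c 0 != 0 by apply: c0; rewrite normr0.
have nx := c0 x x1.
have : P.[0] * P.[1] < 0.
  rewrite !PE scale0r scale1r; move: sx n0 nx; rewrite /s.
  case: (sgrP (tensor_poly c 0)) => // h0 + _; case: (sgrP (tensor_poly c x)) => // hx.
  - by rewrite eqxx.
  - by move=> _ _; rewrite pmulr_rlt0.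
  - by move=> _ _; rewrite nmulr_rlt0.
  - by rewrite eqxx.
move=> /(poly_ivtoo ler01)[t t01]; rewrite rootE PE => /eqP tx.
have /c0 : `|t *: x| <= 1.
  rewrite normrZ mulr_ile1//; rewrite ger0_norm ?(itvP t01)//.
by rewrite tx eqxx.
Qed.

End tensor_products.

(** * Interior and boundary of the image of the cube *)

Section chart_topology.
Context {R : realType} (d : nat).
Variables (F : 'rV[R]_d -> 'rV[R]_d) (G : 'rV[R]_d -> 'M[R]_d) (K L : R).
Hypothesis FG : chart F G K L.

Let T := F @` [set x | `|x| <= 1].

(** The radius is small enough for the cube around x0 to stay in the unit cube and
    for the contraction constant to be at most 1/2. *)
Lemma parallelepiped_sub_chart (x0 : 'rV[R]_d) : `|x0| < 1 ->
  exists2 r, 0 < r & parallelepiped F (G x0) x0 r `<=` T.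
Proof.
move=> x01; have K0 := chart_K0 FG; have L0 := chart_L0 FG.
have KL0 : 0 < 4 * K * L + 1 by rewrite ltr_wpDl// !mulr_ge0.
pose r := Num.min (1 - `|x0|) (4 * K * L + 1)^-1.
have r0 : 0 < r by rewrite lt_min subr_gt0 x01 invr_gt0.
have rx : r <= 1 - `|x0| by rewrite ge_min lexx.
have rKL : 2 * K * L * r <= 1 / 2.
  have : r <= (4 * K * L + 1)^-1 by rewrite ge_min lexx orbT.
  rewrite -[leRHS]mul1r ler_pdivlMr// => h.
  by have := ltW r0; lra.
have cube x : `|x - x0| <= r -> `|x| <= 1.
  move=> xr; rewrite -[x](subrK x0); apply: le_trans (ler_normD _ _) _; lra.
have [uG invG] := chart_inv FG (ltW x01).
have FA x y : `|x - x0| <= r -> `|y - x0| <= r ->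
    `|F x - F y - (x - y) *m G x0| <= K * (`|x - x0| + `|y - x0|) * `|x - y|.
  move=> /cube/norm_le2 x2 /cube/norm_le2 y2.
  by have [] := chart_C11 FG x2 y2 (norm_le2 (ltW x01)).
exists (r / 2); first exact: divr_gt0.
move=> y yP; have eta1 : 2 * K * L * r < 1 by lra.
have [|x xr <-] := parallelepiped_sub_image (ltW r0) K0 L0 uG invG FA eta1 (y := y).
  apply: le_trans yP _; rewrite mulrC ler_wpM2r ?(ltW r0)//; lra.
by exists x => //=; exact: cube.
Qed.

(** The parallelepiped around F x0 contains a ball. *)
Lemma chart_interior (x0 : 'rV[R]_d) : `|x0| < 1 -> T° (F x0).
Proof.
move=> x01; have [r r0 rT] := parallelepiped_sub_chart x01.
have [uG invG] := chart_inv FG (ltW x01); have L0 := chart_L0 FG.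
have L1 : 0 < L + 1 by rewrite ltr_wpDl.
apply/nbhs_ballP; exists (r / (L + 1)); first exact: divr_gt0.
move=> y; rewrite -ball_normE /= => Fy; apply: rT; rewrite /parallelepiped /=.
apply: le_trans (invG _) _; rewrite distrC.
apply: (@le_trans _ _ ((L + 1) * `|F x0 - y|)); first by rewrite ler_wpM2r// lerDl.
by rewrite mulrC -ler_pdivlMr// ltW.
Qed.

Lemma leb_chart_elt_gt0 : (0 < leb T)%E.
Proof.
have z1 : `|0 : 'rV[R]_d| < 1 by rewrite normr0.
have [r r0 rT] := parallelepiped_sub_chart z1.
have [uG invG] := chart_inv FG (ltW z1).
have [mP lebP] := leb_parallelepiped F 0 uG (ltW r0).
apply: lt_le_trans (leb_le mP (measurable_chart_elt FG) rT); rewrite lebP lte_fin.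
rewrite mulr_gt0 ?exprn_gt0 ?mulr_gt0// normr_gt0.
by rewrite -unitfE -unitmxE.
Qed.

Lemma leb_setU_le (A B : set 'rV[R]_d) : measurable A -> measurable B ->
  (leb (A `|` B) <= leb A + leb B)%E.
Proof. by move=> mA mB; exact: measureU2. Qed.

Lemma leb_bigsetU_null (J : Type) (s : seq J) (A : J -> set 'rV[R]_d) :
  (forall j, measurable (A j)) -> (forall j, leb (A j) = 0%E) ->
  leb (\big[setU/set0]_(j <- s) A j) = 0%E.
Proof.
move=> mA A0; elim: s => [|j s IHs]; first by rewrite big_nil measure0.
rewrite big_cons; apply/le_anti; rewrite measure_ge0 andbT.
apply: le_trans (leb_setU_le _ _) _ => //; first exact: bigsetU_measurable.
by rewrite A0 IHs adde0.
Qed.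

(** By chart_interior, a point of the image that is not interior to it comes from
    a face of the cube. *)
Lemma leb_chart_boundary : measurable (T `\` T°) /\ leb (T `\` T°) = 0%E.
Proof.
have mT := measurable_chart_elt FG.
have mI : measurable (T `\` T°).
  by apply: measurableD => //; apply: measurable_open; exact: open_interior.
split => //; apply/le_anti; rewrite measure_ge0 andbT.
pose face (s : R) j := F @` [set x : 'rV[R]_d | `|x| <= 1 /\ x 0 j = s].
have n1 : `|1| <= 1 :> R by rewrite normr1.
have nN1 : `|-1| <= 1 :> R by rewrite normrN normr1.
have mf s j : `|s| <= 1 -> measurable (face s j) by move=> s1; apply: (measurable_chart_face FG).
pose B s := \big[setU/set0]_(j <- enum 'I_d) face s j.
have mB s : `|s| <= 1 -> measurable (B s).
  by move=> s1; apply: bigsetU_measurable => j _; exact: mf.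
have B0 s : `|s| <= 1 -> leb (B s) = 0%E.
  move=> s1; apply: leb_bigsetU_null => j; first exact: mf.
  exact: (leb_chart_face FG).
rewrite -[X in (_ <= X)%E]adde0 -[X in (_ <= X + _)%E](B0 _ n1) -[X in (_ <= _ + X)%E](B0 _ nN1).
apply: le_trans (leb_setU_le _ _); [|exact: mB|exact: mB].
apply: leb_le => //; first by apply: measurableU; exact: mB.
move=> _ [[x /= x1 <-] nI].
have [j xj] : exists j, `|x 0 j| = 1.
  apply: contrapT => H; apply: nI; apply: chart_interior.
  have := x1; rewrite le_eqVlt => /predU1P[x1E|//]; exfalso; apply: H.
  have : mx_norm x != 0 by rewrite -[mx_norm x]/`|x| x1E oner_eq0.
  by move=> /mx_norm_neq0[[k j]]; rewrite -[mx_norm x]/`|x| x1E (ord1 k) /= => ->; exists j.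
have Bs s : x 0 j = s -> B s (F x).
  by move=> xs; rewrite /B -bigcup_seq; exists j; [rewrite /= mem_enum|exists x].
have [xj0|xj0] := leP 0 (x 0 j); [left|right]; apply: Bs.
  by rewrite -xj ger0_norm.
by rewrite -xj ltr0_norm// opprK.
Qed.

End chart_topology.

(** * Quadrature on a mesh element *)

Section element.
Context {R : realType} (d : nat).

Lemma ref_cubeE : @ref_cube R d = [set x | `|x| <= 1].
Proof.
rewrite unit_cube_box; apply/seteqP; split => x /= H j; have := H j; by rewrite !mxE.
Qed.

Lemma frob_dot_ge0 m n (A : 'M[R]_(m, n)) : 0 <= frob_dot A A.
Proof. by apply: sumr_ge0 => i _; apply: sumr_ge0 => j _; rewrite -expr2 sqr_ge0. Qed.

Lemma ler_entry_frob m n (A : 'M[R]_(m, n)) i j : `|A i j| <= frob A.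
Proof.
rewrite -sqrtr_sqr ler_wsqrtr// /frob_dot (bigD1 i)//= (bigD1 j)//= -addrA -expr2 lerDl.
by rewrite addr_ge0// sumr_ge0// => k _; rewrite ?sumr_ge0 -?expr2 ?sqr_ge0// => l _;
  rewrite -expr2 sqr_ge0.
Qed.

(** Element maps have polynomial components, and shape regularity bounds the
    inverses of their gradients. *)
Lemma mesh_chart (I : finType) (F : I -> 'rV[R]_d -> 'rV[R]_d) (p : I -> nat)
    (Omega : set 'rV[R]_d) (gamma : R) (hmesh : fe_mesh F p Omega gamma) (i : I) :
  exists G K L, chart (F i) G K L /\
    forall x, `|x| <= 1 -> jacobian (F i) x = G x.
Proof.
have CF j : C11 (fun x => F i x 0 j).
  have [c cE] := mesh_multilinear hmesh i j.
  have -> : (fun x => F i x 0 j) = tensor_poly c by apply/funext.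
  exact: C11_tensor_poly.
have [G FG] := C11_map CF.
have JG x : `|x| <= 1 -> jacobian (F i) x = G x.
  by move=> x1; apply: jacobian_C11_map FG _; rewrite (le_lt_trans x1)// ltr1n.
have [K K0 HK] := FG.
have sh x : `|x| <= 1 -> [/\ jacobian (F i) x \in unitmx,
        frob (jacobian (F i) x) <= gamma * diam (elt F i) &
        frob (invmx (jacobian (F i) x)) <= gamma / diam (elt F i)].
  by move=> x1; apply: (mesh_shape_regular hmesh); rewrite ref_cubeE.
have e0 : 0 <= gamma / diam (elt F i).
  have [|_ _ h] := sh 0; first by rewrite normr0.
  exact: le_trans (sqrtr_ge0 _) h.
exists G, K, (d%:R * (gamma / diam (elt F i))); split => //; split => //.
- by rewrite mulr_ge0.
- move=> x x1; have [uJ _ nJ] := sh x x1; rewrite JG// in uJ nJ; split => // h.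
  by apply: mulmx_norm_le => // k l; apply: le_trans (ler_entry_frob _ _ _) nJ.
- move=> x y x1 y1; apply: (mesh_inj hmesh); by rewrite inE ref_cubeE.
Qed.

Variables (I : finType) (Omega : set 'rV[R]_d).
Variables (F : I -> 'rV[R]_d -> 'rV[R]_d) (p : I -> nat) (gamma : R).
Hypothesis hmesh : fe_mesh F p Omega gamma.
Variable xi : forall n : nat, 'I_n -> R.
Hypothesis hxi : forall n, gauss_nodes (@xi n).
Hypothesis hdet : forall i, (2 <= p i)%N -> poly_on_cube 1 (det_grad (F i)).

(** The weights for which the two cases of the element quadrature become a single
    sum over the Gauss points: for p = 1 the only one is the origin. *)
Definition elt_weight i (k : {ffun 'I_d -> 'I_(p i)}) : R :=
  if p i == 1%N then fine (leb (elt F i))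
  else tensor_weight (@xi (p i)) k * `|det_grad (F i) (gauss_point (@xi (p i)) k)|.

Lemma eltE i : elt F i = F i @` [set x | `|x| <= 1].
Proof. by rewrite /elt ref_cubeE. Qed.

Lemma measurable_elt i : measurable (elt F i).
Proof.
have [G [K [L [FG _]]]] := mesh_chart hmesh i.
by rewrite eltE; exact: measurable_chart_elt FG.
Qed.

Lemma leb_elt_gt0 i : (0 < leb (elt F i))%E.
Proof.
have [G [K [L [FG _]]]] := mesh_chart hmesh i.
by rewrite eltE; exact: leb_chart_elt_gt0 FG.
Qed.

Lemma leb_elt_fin i : (leb (elt F i) < +oo)%E.
Proof.
have [G [K [L [FG _]]]] := mesh_chart hmesh i.
by rewrite eltE; exact: leb_chart_elt_fin FG.
Qed.

Lemma gauss_point_norm n (k : {ffun 'I_d -> 'I_n}) : `|gauss_point (@xi n) k| <= 1.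
Proof.
apply: rV_norm_le => // j; rewrite mxE.
by have /andP[h1 h2] := gauss_node_itv (hxi n) (k j); rewrite ler_norml !ltW.
Qed.

Lemma gauss_node1 (k : 'I_1) : @xi 1 k = 0.
Proof.
have [_ /(_ k)] := hxi 1.
rewrite /root /legendre derivn1 expr1 derivB derivXn -polyC1 derivC subr0.
rewrite hornerZ hornerMn expr1 hornerX mulf_eq0 invr_eq0 mulf_eq0 !pnatr_eq0 /=.
by rewrite mulrn_eq0 /= => /eqP.
Qed.

Lemma sum_gauss_point1 n (f : 'rV[R]_d -> R) : n = 1%N ->
  \sum_(k : {ffun 'I_d -> 'I_n}) f (gauss_point (@xi n) k) = f 0.
Proof.
move=> ->; rewrite (eq_bigr (fun=> f 0)); last first.
  move=> k _; congr (f _); apply/rowP => j; rewrite !mxE; exact: gauss_node1.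
by rewrite sumr_const card_ffun !card_ord exp1n.
Qed.

Lemma quad_hpE i (phi : 'rV[R]_d -> R) :
  quad_hp F p xi i phi =
  \sum_k elt_weight k * phi (F i (gauss_point (@xi (p i)) k)).
Proof.
rewrite /quad_hp /elt_weight; have [p1|//] := eqVneq (p i) 1%N.
by rewrite (sum_gauss_point1 (fun x => fine (leb (elt F i)) * phi (F i x)) p1).
Qed.

Lemma det_grad_neq0 i x : `|x| <= 1 -> det_grad (F i) x != 0.
Proof.
move=> x1; have [|u _ _] := @mesh_shape_regular _ _ _ _ _ _ _ hmesh i x.
  by rewrite ref_cubeE.
by rewrite /det_grad -unitfE -unitmxE.
Qed.

Lemma elt_weight_gt0 i (k : {ffun 'I_d -> 'I_(p i)}) : 0 < elt_weight k.
Proof.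
rewrite /elt_weight; case: ifPn => _; first by rewrite fine_gt0// leb_elt_gt0 leb_elt_fin.
rewrite mulr_gt0// ?normr_gt0 ?det_grad_neq0 ?gauss_point_norm//.
by apply: prodr_gt0 => j _; exact: gauss_weight_gt0.
Qed.

Lemma elt_pullback i r (a : 'rV[R]_d -> R) : poly_on_cube r (fun x => a (F i x)) ->
  exists c : {ffun 'I_d -> 'I_r.+1} -> R, forall x, `|x| <= 1 -> a (F i x) = tensor_poly c x.
Proof. by move=> [c cE]; exists c => x x1; apply: cE; rewrite ref_cubeE. Qed.

Lemma measurable_elt_fun i r (a : 'rV[R]_d -> R) : poly_on_cube r (fun x => a (F i x)) ->
  measurable_fun (elt F i) a.
Proof.
move=> /elt_pullback[c cE]; have [G [K [L [FG _]]]] := mesh_chart hmesh i.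
by rewrite eltE; apply: (measurable_pullback FG) cE; exact: C11_tensor_poly.
Qed.

Lemma integrable_elt_mul i r (a b : 'rV[R]_d -> R) :
  poly_on_cube r (fun x => a (F i x)) -> poly_on_cube r (fun x => b (F i x)) ->
  (@leb R d).-integrable (elt F i) (EFin \o (fun y => a y * b y)).
Proof.
move=> /elt_pullback[c cE] /elt_pullback[c' cE'].
have [G [K [L [FG _]]]] := mesh_chart hmesh i; rewrite eltE.
apply: (integrable_pullback FG (P := fun x => tensor_poly c x * tensor_poly c' x)).
  by apply: C11M; exact: C11_tensor_poly.
by move=> x x1; rewrite cE// cE'.
Qed.

(** For p = 1 the functions are constant on the element. For p >= 2 the pullback of
    the integrand has degree at most 2 (p - 1) in each variable, the determinant
    has degree at most 1, and the p-point Gauss rule is exact up to degree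
    2 p - 1. *)
Lemma elt_quadrature i (a b : 'rV[R]_d -> R) :
  poly_on_cube (p i).-1 (fun x => a (F i x)) -> poly_on_cube (p i).-1 (fun x => b (F i x)) ->
  \int[@leb R d]_(y in elt F i) (a y * b y) =
  \sum_k elt_weight k * (a (F i (gauss_point (@xi (p i)) k)) * b (F i (gauss_point (@xi (p i)) k))).
Proof.
move=> pa pb; have [ca caE] := elt_pullback pa; have [cb cbE] := elt_pullback pb.
have [p1|pn1] := eqVneq (p i) 1%N.
  rewrite -(quad_hpE i (fun y => a y * b y)) /quad_hp p1 eqxx.
  have cst (c : {ffun 'I_d -> 'I_((p i).-1).+1} -> R) x : tensor_poly c x = tensor_poly c 0.
    apply: eq_bigr => e _; congr (_ * _); apply: eq_bigr => j _.
    have -> : e j = 0 :> nat.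
      by have := ltn_ord (e j); rewrite [X in (_ < X.-1.+1)%N]p1 ltnS leqn0 => /eqP.
    by rewrite !expr0.
  have z1 : `|0 : 'rV[R]_d| <= 1 by rewrite normr0.
  rewrite mulrC -Rintegral_cst; last exact: measurable_elt.
  apply: eq_Rintegral => y; rewrite inE eltE => -[x /= x1 <-].
  by rewrite !caE// !cbE// (cst ca) (cst cb).
have p2 : (2 <= p i)%N by move: (mesh_degree_gt0 hmesh i); case: (p i) pn1 => [|[]].
have [cd cdE'] := hdet p2.
have cdE x : `|x| <= 1 -> det_grad (F i) x = tensor_poly cd x.
  by move=> x1; apply: cdE'; rewrite ref_cubeE.
have [G [K [L [FG JG]]]] := mesh_chart hmesh i.
have [s [s1 sE]] : exists s : R, `|s| = 1 /\ forall x, `|x| <= 1 ->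
    `|tensor_poly cd x| = s * tensor_poly cd x.
  by apply: tensor_poly_sign => x x1; rewrite -cdE// det_grad_neq0.
have PDE x := tensor_poly3 ca cb cd x.
set c3 := (fun a : _ * _ => _) in PDE; set u3 := (fun a j => _) in PDE.
rewrite eltE (change_of_variables FG (P := fun x => tensor_poly ca x * tensor_poly cb x)
  (D := tensor_poly cd) (s := s) (Psi := sep_int c3 u3)).
- rewrite (sep_int_gauss c3 (hxi (p i))); last first.
    move=> [[e1 e2] e3] j; rewrite /u3 /= size_polyXn.
    have := ltn_ord (e1 j); have := ltn_ord (e2 j); have := ltn_ord (e3 j).
    rewrite !ltnS => h3 h2 h1.
    apply: (@leq_trans ((p i).-1 + (p i).-1 + 1).+1).
      by rewrite ltnS leq_add// leq_add.
    by rewrite addn1 addnn -doubleS prednK// (mesh_degree_gt0 hmesh).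
  rewrite mulr_sumr; apply: eq_bigr => k _; have k1 := gauss_point_norm k.
  rewrite /elt_weight (negbTE pn1) cdE// sE// caE// cbE// -PDE; ring.
- by apply: C11M; exact: C11_tensor_poly.
- exact: C11_tensor_poly.
- exact: s1.
- by move=> x x1; rewrite -JG// -sE// -cdE.
- exact: sep_int_split.
- have [M M0 H] := sep_int_cube c3 u3; exists M => // x0 r r0 a1 b1.
  by rewrite PDE; exact: H.
- by move=> x x1; rewrite caE// cbE.
Qed.

End element.

(** * Lipschitz domains and their decomposition into elements *)

Section lipschitz_domain.
Context {R : realType} (d : nat).
Implicit Types x y e : 'rV[R]_d.

Lemma frob_dotBl x y e : frob_dot (x - y) e = frob_dot x e - frob_dot y e.
Proof.
rewrite /frob_dot -sumrB; apply: eq_bigr => i _; rewrite -sumrB.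
by apply: eq_bigr => j _; rewrite !mxE mulrBl.
Qed.

Lemma frob_dotZl (t : R) x e : frob_dot (t *: x) e = t * frob_dot x e.
Proof.
rewrite /frob_dot mulr_sumr; apply: eq_bigr => i _; rewrite mulr_sumr.
by apply: eq_bigr => j _; rewrite !mxE mulrA.
Qed.

Lemma frob_dot_le x e : `|frob_dot x e| <= d%:R * `|e| * `|x|.
Proof.
rewrite /frob_dot big_ord1; apply: le_trans (ler_norm_sum _ _ _) _.
rewrite -mulrA mulr_natl -[X in _ *+ X](card_ord d) -sumr_const.
by apply: ler_sum => j _; rewrite normrM mulrC ler_pM// ler_entry_norm.
Qed.

Lemma frob1_dot e : frob e = 1 -> frob_dot e e = 1.
Proof. by move=> e1; rewrite -[LHS]sqr_sqrtr ?frob_dot_ge0// -/(frob e) e1 expr1n. Qed.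

(** Near a boundary point x0 the domain is a strict epigraph in the direction e,
    so the points x0 - t e with t > 0 small lie strictly below the graph, hence
    outside the closure: x0 is not interior to the closure. *)
Lemma lipschitz_boundary_interior_closure (Omega : set 'rV[R]_d) :
  open Omega -> lipschitz_boundary Omega -> (closure Omega)° `<=` Omega.
Proof.
move=> oO lO x0 x0i; apply: contrapT => nO.
have [] := lO x0 (interior_subset x0i) (fun h => nO (interior_subset h)).
move=> e [g [e1 gl nO']].
have [k k0 gk] : exists2 k, 0 < k & forall x y, `|g x - g y| <= k * `|x - y|.
  have [M [_ HM]] := gl; exists (Num.max M 0 + 1).
    by rewrite ltr_wpDl// le_max lexx orbT.
  move=> x y; apply: (HM _ _ (x, y)) => //.
  by rewrite (le_lt_trans (_ : M <= Num.max M 0)) ?le_max ?lexx// ltrDl.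
have /nbhs_ballP[eps /= eps0 Heps] : \forall x \near x0, closure Omega x /\
    (Omega x <-> g (x - frob_dot x e *: e) < frob_dot x e).
  by apply: filterI nO'; exact: x0i.
rewrite -ball_normE in Heps.
have ne0 : 0 < `|e| + 1 by rewrite ltr_wpDl.
pose t := eps / 2 / (`|e| + 1); pose xt := x0 - t *: e.
have t0 : 0 < t by rewrite !divr_gt0.
have te : `|t *: e| <= eps / 2.
  have e20 : 0 <= eps / 2 by rewrite divr_ge0// ltW.
  by rewrite normrZ (gtr0_norm t0) /t mulrAC ler_pdivrMr// ler_wpM2l// lerDl.
have g0 : frob_dot x0 e <= g (x0 - frob_dot x0 e *: e).
  rewrite leNgt; apply/negP => h; apply: nO.
  have [|_ [_ H]] := Heps x0; last exact: H.
  by rewrite /ball_ /= subrr normr0.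
pose h x := g (x - frob_dot x e *: e) - frob_dot x e.
have ht : t <= h xt.
  rewrite /h /xt frob_dotBl frob_dotZl (frob1_dot e1) mulr1.
  have -> : x0 - t *: e - (frob_dot x0 e - t) *: e = x0 - frob_dot x0 e *: e.
    by apply/rowP => j; rewrite !mxE; ring.
  by move: g0; lra.
pose C := k * (1 + d%:R * `|e| * `|e|) + d%:R * `|e|.
have C0 : 0 <= C by rewrite !addr_ge0 ?mulr_ge0 ?addr_ge0 ?(ltW k0).
have hC x y : `|h x - h y| <= C * `|x - y|.
  have -> : h x - h y =
      (g (x - frob_dot x e *: e) - g (y - frob_dot y e *: e)) - frob_dot (x - y) e.
    by rewrite /h frob_dotBl; ring.
  apply: le_trans (ler_normB _ _) _; rewrite /C mulrDl lerD ?frob_dot_le//.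
  apply: le_trans (gk _ _) _; rewrite -mulrA ler_wpM2l ?(ltW k0)//.
  have -> : x - frob_dot x e *: e - (y - frob_dot y e *: e) = (x - y) - frob_dot (x - y) e *: e.
    by rewrite frob_dotBl; apply/rowP => j; rewrite !mxE; ring.
  apply: le_trans (ler_normB _ _) _; rewrite mulrDl mul1r lerD// normrZ mulrAC.
  by rewrite ler_wpM2r// frob_dot_le.
have C1 : 0 < C + 1 by rewrite ltr_wpDl.
pose del := Num.min (eps / 2) (t / (C + 1)).
have del0 : 0 < del by rewrite lt_min !divr_gt0.
have clxt : closure Omega xt.
  have [|] := Heps xt => //.
  rewrite /ball_ /= /xt opprB addrCA subrr addr0 (le_lt_trans te)//.
  by rewrite ltr_pdivrMr// ltr_pMr// ltr1n.
have [y [Oy]] := clxt _ (nbhsx_ballx xt del del0).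
rewrite -ball_normE /ball_ /= => xty.
have [_ [+ _]] : closure Omega y /\ (Omega y <-> g (y - frob_dot y e *: e) < frob_dot y e).
  apply: Heps; rewrite /ball_ /=.
  have -> : x0 - y = (xt - y) + t *: e by rewrite /xt addrAC subrK.
  apply: le_lt_trans (ler_normD _ _) _.
  have : `|xt - y| < eps / 2 by rewrite (lt_le_trans xty)// ge_min lexx.
  by move: te; lra.
move=> /(_ Oy); rewrite -subr_lt0 -/(h y) => hy.
have := hC xt y; have : `|xt - y| < t / (C + 1).
  by rewrite (lt_le_trans xty)// ge_min lexx orbT.
rewrite ltr_pdivlMr// => h1 h2.
have h3 := ler_norm (h xt - h y); have h4 := normr_ge0 (xt - y).
by move: (`|xt - y|) h1 h2 h3 h4 => D; lra.
Qed.

End lipschitz_domain.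

Section domain_decomposition.
Context {R : realType} (d : nat) (I : finType) (Omega : set 'rV[R]_d).
Variables (F : I -> 'rV[R]_d -> 'rV[R]_d) (p : I -> nat) (gamma : R).
Hypothesis hOmega : bounded_lipschitz_domain Omega.
Hypothesis hmesh : fe_mesh F p Omega gamma.

Lemma measurable_domain : measurable Omega.
Proof. by case: hOmega => _ oO _ _ _; exact: measurable_open. Qed.

Lemma elt_boundary_null i :
  measurable (elt F i `\` (elt F i)°) /\ leb (elt F i `\` (elt F i)°) = 0%E.
Proof.
have [G [K [L [FG _]]]] := mesh_chart hmesh i.
by rewrite eltE; exact: leb_chart_boundary FG.
Qed.

Lemma measurable_elt_interior i : measurable (elt F i)°.
Proof. by apply: measurable_open; exact: open_interior. Qed.

(** The interior of an element lies in the interior of the closure of Omega, which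
    is Omega itself for a Lipschitz domain; so the boundary of Omega carries no
    mass of the elements. *)
Lemma elt_interior_sub i : (elt F i)° `<=` Omega.
Proof.
case: hOmega => _ oO _ _ lO; apply: subset_trans (lipschitz_boundary_interior_closure oO lO).
by apply: interiorS; rewrite -(mesh_cover hmesh) => x Fx; exists i.
Qed.

Lemma elt_interior_disjoint i j x : (elt F i)° x -> (elt F j)° x -> i = j.
Proof.
move=> xi xj; apply/eqP; apply: contraT => ij.
by have := mesh_disjoint hmesh ij; rewrite -subset0 => /(_ x)[].
Qed.

Lemma ae_elt_interior : {ae @leb R d, forall x, Omega x -> exists i, (elt F i)° x}.
Proof.
pose N := \big[setU/set0]_(i <- enum I) (elt F i `\` (elt F i)°).
exists N; split.
- by apply: bigsetU_measurable => i _; have [] := elt_boundary_null i.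
- by apply: leb_bigsetU_null => i; have [] := elt_boundary_null i.
move=> x /= /not_implyP[Ox nx].
have : closure Omega x by exact: subset_closure.
rewrite -(mesh_cover hmesh) => -[i _ xi]; rewrite /N -bigcup_seq.
exists i; first by rewrite /= mem_enum.
by split => // xi'; apply: nx; exists i.
Qed.

Lemma Rintegral_elt_interior i (v : 'rV[R]_d -> R) :
  (@leb R d).-integrable (elt F i) (EFin \o v) ->
  \int[@leb R d]_(x in (elt F i)°) v x = \int[@leb R d]_(x in elt F i) v x.
Proof.
move=> vi; have [mN N0] := elt_boundary_null i.
rewrite /Rintegral (negligible_integral mN (measurable_elt hmesh i) vi N0) setDD.
by rewrite (_ : _ `&` _ = (elt F i)°)//; apply/setIidr; exact: interior_subset.
Qed.

(** Up to null sets, Omega is the disjoint union of the interiors of the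
    elements. *)
Lemma Rintegral_domain (u : 'rV[R]_d -> R) (v : I -> 'rV[R]_d -> R) :
  measurable_fun Omega u ->
  (forall i, (@leb R d).-integrable (elt F i) (EFin \o v i)) ->
  (forall i, {ae @leb R d, forall x, elt F i x -> u x = v i x}) ->
  \int[@leb R d]_(x in Omega) u x = \sum_i \int[@leb R d]_(x in elt F i) v i x.
Proof.
move=> mu vi uv.
have mO := measurable_domain.
pose w i : 'rV[R]_d -> R := v i \_ (elt F i)°.
have wi i : (@leb R d).-integrable Omega (EFin \o w i).
  rewrite /w -restrict_EFin.
  apply/(integrable_restrict _ (measurable_elt_interior i) mO).
  rewrite setIidr; last exact: elt_interior_sub.
  apply: integrableS (vi i); first exact: (measurable_elt hmesh).
    exact: measurable_elt_interior.
  exact: interior_subset.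
have [sumi sumE] := Rintegral_sum (index_enum I) mO wi.
transitivity (\int[@leb R d]_(x in Omega) (\sum_i w i x)).
  rewrite /Rintegral; congr fine; apply: ae_eq_integral => //.
  - exact/measurable_EFinP.
  - exact: measurable_int sumi.
  have : {ae @leb R d, forall x, forall i, elt F i x -> u x = v i x}.
    exact: filter_forall uv.
  apply: filterS2 ae_elt_interior => x Hx uvx Ox /=; congr EFin.
  have [i xi] := Hx Ox; rewrite (uvx i (interior_subset xi)) (bigD1 i)//= big1 ?addr0.
    by rewrite /w patchE mem_set.
  move=> j ji; rewrite /w patchE; case: ifPn => // /set_mem xj.
  by rewrite (elt_interior_disjoint xj xi) eqxx in ji.
rewrite sumE; apply: eq_bigr => i _; rewrite -Rintegral_elt_interior//.
rewrite /w -Rintegral_mkcondr setIidr//; exact: elt_interior_sub.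
Qed.

End domain_decomposition.

(** * Discrete spaces and their nodal values *)

Section frobenius.
Context {R : realType}.

Lemma frob_dot0r m n (A : 'M[R]_(m, n)) : frob_dot A 0 = 0.
Proof. by rewrite /frob_dot big1// => i _; rewrite big1// => j _; rewrite mxE mulr0. Qed.

Lemma sqr_frob m n (A : 'M[R]_(m, n)) : frob A ^+ 2 = frob_dot A A.
Proof. by rewrite sqr_sqrtr// frob_dot_ge0. Qed.

Lemma frob_eq0 m n (A : 'M[R]_(m, n)) : frob A = 0 -> A = 0.
Proof.
move=> A0; apply/matrixP => i j; rewrite mxE; apply/eqP; rewrite -normr_le0 -A0.
exact: ler_entry_frob.
Qed.

Lemma frobZ m n (t : R) (A : 'M[R]_(m, n)) : frob (t *: A) = `|t| * frob A.
Proof.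
rewrite /frob -sqrtr_sqr -sqrtrM ?sqr_ge0//; congr Num.sqrt.
rewrite /frob_dot mulr_sumr; apply: eq_bigr => i _; rewrite mulr_sumr.
by apply: eq_bigr => j _; rewrite !mxE; ring.
Qed.

Lemma frob_dot_sqrB m n (s t : R) (A B : 'M[R]_(m, n)) :
  frob_dot (s *: A - t *: B) (s *: A - t *: B) =
  s ^+ 2 * frob_dot A A - (2 * s * t) * frob_dot A B + t ^+ 2 * frob_dot B B.
Proof.
rewrite /frob_dot !mulr_sumr -sumrB -big_split /=.
apply: eq_bigr => i _; rewrite !mulr_sumr -sumrB -big_split /=.
by apply: eq_bigr => j _; rewrite !mxE; ring.
Qed.

(** Expand the squared norm of <B,B> A - <A,B> B, which is nonnegative. *)
Lemma frob_cauchy_schwarz m n (A B : 'M[R]_(m, n)) : frob_dot A B <= frob A * frob B.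
Proof.
have [B0|Bn0] := eqVneq (frob B) 0; first by rewrite (frob_eq0 B0) frob_dot0r mulr_ge0 ?sqrtr_ge0.
pose a := frob_dot A A; pose b := frob_dot A B; pose c := frob_dot B B.
have c0 : 0 < c by rewrite /c -sqr_frob exprn_gt0// lt_def Bn0 sqrtr_ge0.
have E : frob_dot (c *: A - b *: B) (c *: A - b *: B) = c * (c * a - b ^+ 2).
  by rewrite frob_dot_sqrB -/a -/b -/c; ring.
have : 0 <= c * (c * a - b ^+ 2) by rewrite -E frob_dot_ge0.
rewrite pmulr_rge0// subr_ge0 => bca.
rewrite /frob -/a -/b -/c -sqrtrM ?frob_dot_ge0//; apply: le_trans (ler_norm b) _.
by rewrite -sqrtr_sqr ler_wsqrtr// mulrC.
Qed.

End frobenius.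

Section poly_on_cube_closure.
Context {R : realType} (d r : nat).
Implicit Types f g : 'rV[R]_d -> R.

Lemma poly_on_cubeD f g : poly_on_cube r f -> poly_on_cube r g ->
  poly_on_cube r (fun x => f x + g x).
Proof.
move=> [c fc] [c' gc']; exists (fun a => c a + c' a) => x x1.
by rewrite fc// gc'// -big_split; apply: eq_bigr => a _; rewrite mulrDl.
Qed.

Lemma poly_on_cubeZ (t : R) f : poly_on_cube r f -> poly_on_cube r (fun x => t * f x).
Proof.
move=> [c fc]; exists (fun a => t * c a) => x x1.
by rewrite fc// mulr_sumr; apply: eq_bigr => a _; rewrite mulrA.
Qed.

Lemma poly_on_cube0 : poly_on_cube r (fun _ : 'rV[R]_d => 0).
Proof. by exists (fun=> 0) => x _; rewrite /tensor_poly big1// => a _; rewrite mul0r. Qed.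

Lemma poly_on_cube_sum (J : Type) (s : seq J) (f : J -> 'rV[R]_d -> R) :
  (forall i, poly_on_cube r (f i)) -> poly_on_cube r (fun x => \sum_(i <- s) f i x).
Proof.
move=> Pf; elim: s => [|i s IHs].
  have -> : (fun x => \sum_(i <- [::]) f i x) = (fun=> 0) by apply/funext => x; rewrite big_nil.
  exact: poly_on_cube0.
have -> : (fun x => \sum_(j <- i :: s) f j x) = (fun x => f i x + \sum_(j <- s) f j x).
  by apply/funext => x; rewrite big_cons.
exact: poly_on_cubeD.
Qed.

Lemma poly_on_cube_prod (u : 'I_d -> {poly R}) : (forall j, (size (u j) <= r.+1)%N) ->
  poly_on_cube r (fun x => \prod_j (u j).[x 0 j]).
Proof.
move=> ur; exists (fun a : {ffun 'I_d -> 'I_r.+1} => \prod_j (u j)`_(a j)) => x _.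
under eq_bigr do rewrite (horner_coef_wide _ (ur _)).
by rewrite bigA_distr_bigA; apply: eq_bigr => a _; rewrite big_split.
Qed.

End poly_on_cube_closure.

Section discrete_spaces.
Context {R : realType} (d : nat) (I : finType) (Omega : set 'rV[R]_d).
Variables (F : I -> 'rV[R]_d -> 'rV[R]_d) (p : I -> nat) (gamma : R).
Hypothesis hOmega : bounded_lipschitz_domain Omega.
Hypothesis hmesh : fe_mesh F p Omega gamma.
Variable xi : forall n : nat, 'I_n -> R.
Hypothesis hxi : forall n, gauss_nodes (@xi n).
Hypothesis hdet : forall i, (2 <= p i)%N -> poly_on_cube 1 (det_grad (F i)).

Local Notation weight k := (elt_weight F xi k).
Local Notation node k := (F _ (gauss_point (@xi (p _)) k)).

Lemma ae_elt_in_interior i : {ae @leb R d, forall x, elt F i x -> (elt F i)° x}.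
Proof.
have [mN N0] := elt_boundary_null hmesh i.
by exists (elt F i `\` (elt F i)°); split => // x /= /not_implyP[].
Qed.

(** The quadrature is exact on the square of a, has positive weights, and the
    integral of the square is zero. *)
Lemma elt_vanish i (a : 'rV[R]_d -> R) (k : {ffun 'I_d -> 'I_(p i)}) :
  poly_on_cube (p i).-1 (fun x => a (F i x)) ->
  {ae @leb R d, forall x, elt F i x -> a x = 0} ->
  a (F i (gauss_point (@xi (p i)) k)) = 0.
Proof.
move=> pa a0; have := elt_quadrature hmesh hxi hdet pa pa.
have -> : \int[@leb R d]_(y in elt F i) (a y * a y) = 0.
  rewrite /Rintegral (_ : (\int[_]_(x in _) _)%E = (\int[@leb R d]_(x in elt F i) 0)%E).
    by rewrite integral0.
  apply: ae_eq_integral => //.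
  - exact: measurable_elt hmesh i.
  - exact: measurable_int (integrable_elt_mul hmesh pa pa).
  - by apply: filterS a0 => x ax Tx; rewrite ax// mulr0.
move=> /esym/eqP; rewrite psumr_eq0; last first.
  by move=> l _; rewrite mulr_ge0 ?(ltW (elt_weight_gt0 hmesh hxi l))// -expr2 sqr_ge0.
move=> /allP/(_ k); rewrite mem_index_enum => /(_ isT) /=.
by rewrite mulf_eq0 (gt_eqF (elt_weight_gt0 hmesh hxi k)) /= mulf_eq0 orbb => /eqP.
Qed.

Lemma elt_reprP q i : Q_hp Omega F p q -> elt_repr F p q i (elt_restr F p q i).
Proof. by move=> [_ /(_ i) Hq]; exact: (xgetPex _ Hq). Qed.

(** The polynomial representatives of a discrete function on an element agree at
    the Gauss points, so nodal values do not depend on the choice made by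
    elt_restr. *)
Lemma elt_repr_nodes q i g h (k : {ffun 'I_d -> 'I_(p i)}) :
  elt_repr F p q i g -> elt_repr F p q i h ->
  g (F i (gauss_point (@xi (p i)) k)) = h (F i (gauss_point (@xi (p i)) k)).
Proof.
move=> [pg qg] [ph qh]; apply/matrixP => l m; apply/eqP; rewrite -subr_eq0; apply/eqP.
apply: (elt_vanish (a := fun y => g y l m - h y l m)).
  have -> : (fun x => g (F i x) l m - h (F i x) l m) =
      (fun x => g (F i x) l m + (-1) * h (F i x) l m).
    by apply/funext => x; rewrite mulN1r.
  by apply: poly_on_cubeD => //; exact: poly_on_cubeZ.
by apply: filterS2 qg qh => x gx hx Tx; rewrite -gx// -hx// subrr.
Qed.

(** Symmetry and vanishing trace hold almost everywhere; at the Gauss points they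
    hold exactly, by elt_vanish. *)
Lemma elt_restr_sym q i (k : {ffun 'I_d -> 'I_(p i)}) : Q_hp Omega F p q ->
  let V := elt_restr F p q i (F i (gauss_point (@xi (p i)) k)) in V^T = V /\ \tr V = 0.
Proof.
move=> Qq V; have [pg qg] := elt_reprP i Qq.
have [[_ _ sym] _] := Qq.
have ae_sym : {ae @leb R d, forall x, elt F i x ->
    (elt_restr F p q i x)^T = elt_restr F p q i x /\ \tr (elt_restr F p q i x) = 0}.
  apply: filterS3 qg sym (ae_elt_in_interior i) => x qx symx inx Tx.
  by rewrite -qx//; apply: symx; apply: (elt_interior_sub hOmega hmesh); exact: inx.
split.
  apply/matrixP => l m; rewrite mxE; apply/eqP; rewrite -subr_eq0; apply/eqP.
  apply: (elt_vanish (a := fun y => elt_restr F p q i y m l - elt_restr F p q i y l m)).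
    have -> : (fun x => elt_restr F p q i (F i x) m l - elt_restr F p q i (F i x) l m) =
        (fun x => elt_restr F p q i (F i x) m l + (-1) * elt_restr F p q i (F i x) l m).
      by apply/funext => x; rewrite mulN1r.
    by apply: poly_on_cubeD => //; exact: poly_on_cubeZ.
  by apply: filterS ae_sym => x /[apply] -[sx _]; rewrite -{1}sx mxE subrr.
apply: (elt_vanish (a := fun y => \tr (elt_restr F p q i y))).
  exact: poly_on_cube_sum.
by apply: filterS ae_sym => x /[apply] -[].
Qed.

Lemma elt_quadrature_dot i (g h : 'rV[R]_d -> 'M[R]_d) :
  (forall l m, poly_on_cube (p i).-1 (fun x => g (F i x) l m)) ->
  (forall l m, poly_on_cube (p i).-1 (fun x => h (F i x) l m)) ->
  (@leb R d).-integrable (elt F i) (EFin \o (fun y => frob_dot (g y) (h y))) /\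
  \int[@leb R d]_(y in elt F i) frob_dot (g y) (h y) =
  \sum_k weight k * frob_dot (g (F i (gauss_point (@xi (p i)) k)))
                             (h (F i (gauss_point (@xi (p i)) k))).
Proof.
move=> pg ph; have mT := measurable_elt hmesh i.
have int l m := integrable_elt_mul hmesh (i := i)
  (a := fun y => g y l m) (b := fun y => h y l m) (pg l m) (ph l m).
have inner l := Rintegral_sum (index_enum 'I_d) mT (int l).
have [outer1 outer2] := Rintegral_sum (index_enum 'I_d) mT (fun l => (inner l).1).
split; first exact: outer1.
rewrite [LHS]outer2.
under eq_bigr => l _ do rewrite (inner l).2.
under eq_bigr => l _ do under eq_bigr => m _ do
  rewrite (elt_quadrature hmesh hxi hdet (i := i)
    (a := fun y => g y l m) (b := fun y => h y l m) (pg l m) (ph l m)).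
under eq_bigr => l _ do rewrite exchange_big.
rewrite exchange_big; apply: eq_bigr => k _ /=.
by rewrite mulr_sumr; apply: eq_bigr => l _; rewrite mulr_sumr.
Qed.

Lemma L2_inner_quadrature (mu q : 'rV[R]_d -> 'M[R]_d) :
  Q_hp Omega F p mu -> Q_hp Omega F p q ->
  L2_inner Omega mu q = \sum_i \sum_(k : {ffun 'I_d -> 'I_(p i)}) weight k *
    frob_dot (elt_restr F p mu i (F i (gauss_point (@xi (p i)) k)))
             (elt_restr F p q i (F i (gauss_point (@xi (p i)) k))).
Proof.
move=> Qmu Qq.
rewrite /L2_inner (Rintegral_domain hOmega hmesh
  (v := fun i y => frob_dot (elt_restr F p mu i y) (elt_restr F p q i y))).
- apply: eq_bigr => i _; apply: (elt_quadrature_dot _ _).2.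
    by have [] := elt_reprP i Qmu.
  by have [] := elt_reprP i Qq.
- have [[mmu _ _] _] := Qmu; have [[mq _ _] _] := Qq.
  apply: measurable_sum => l; apply: measurable_sum => m; apply: measurable_funM.
    exact: (measurableT_comp (measurable_mx_entry l m) mmu).
  exact: (measurableT_comp (measurable_mx_entry l m) mq).
- move=> i; apply: (elt_quadrature_dot _ _).1.
    by have [] := elt_reprP i Qmu.
  by have [] := elt_reprP i Qq.
- move=> i; have [_ h1] := elt_reprP i Qmu; have [_ h2] := elt_reprP i Qq.
  by apply: filterS2 h1 h2 => x e1 e2 Tx; rewrite e1// e2.
Qed.

Lemma psi_hpE sigma q : psi_hp F p xi sigma q =
  \sum_i \sum_(k : {ffun 'I_d -> 'I_(p i)}) weight k *
    (sigma * frob (elt_restr F p q i (F i (gauss_point (@xi (p i)) k)))).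
Proof. by apply: eq_bigr => i _; rewrite (quad_hpE F p hxi). Qed.

End discrete_spaces.

(** * Nodal test functions and the theorem *)

Section nodal_test_function.
Context {R : realType} (d : nat) (I : finType) (Omega : set 'rV[R]_d).
Variables (F : I -> 'rV[R]_d -> 'rV[R]_d) (p : I -> nat) (gamma : R).
Hypothesis hOmega : bounded_lipschitz_domain Omega.
Hypothesis hmesh : fe_mesh F p Omega gamma.
Variable xi : forall n : nat, 'I_n -> R.
Hypothesis hxi : forall n, gauss_nodes (@xi n).
Hypothesis hdet : forall i, (2 <= p i)%N -> poly_on_cube 1 (det_grad (F i)).
Variables (i : I) (k : {ffun 'I_d -> 'I_(p i)}).

Let lag (x : 'rV[R]_d) : R := \prod_j (lagrange_basis (@xi (p i)) (k j)).[x 0 j].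

Let lag_poly : poly_on_cube (p i).-1 lag.
Proof.
apply: poly_on_cube_prod => j; rewrite prednK; last exact: (mesh_degree_gt0 hmesh).
exact: size_lagrange_basis.
Qed.

Let lag_node (l : {ffun 'I_d -> 'I_(p i)}) : lag (gauss_point (@xi (p i)) l) = (l == k)%:R.
Proof.
have lj j : (lagrange_basis (@xi (p i)) (k j)).[gauss_point (@xi (p i)) l 0 j] = (l j == k j)%:R.
  by rewrite mxE lagrange_basisE.
rewrite /lag; have [->|lk] := eqVneq l k.
  by rewrite big1// => j _; rewrite mxE lagrange_basisE// eqxx.
have [j jl] : exists j, l j != k j.
  apply/existsP; apply: contraNT lk => /existsPn H; apply/eqP/ffunP => j.
  by have := H j; rewrite negbK => /eqP.
by rewrite (bigD1 j)//= lj (negbTE jl) mul0r.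
Qed.

(* The default value 0 of the choice of a preimage is never reached on the
   element. *)
Let nodal (y : 'rV[R]_d) : R :=
  lag (xget 0 [set x : 'rV[R]_d | `|x| <= 1 /\ F i x = y]).

Let nodalF x : `|x| <= 1 -> nodal (F i x) = lag x.
Proof.
move=> x1; rewrite /nodal; congr lag.
have [y1 Fy] : [set z : 'rV[R]_d | `|z| <= 1 /\ F i z = F i x]
    (xget 0 [set z : 'rV[R]_d | `|z| <= 1 /\ F i z = F i x]).
  by apply: (xgetPex 0); exists x.
by apply: (mesh_inj hmesh) Fy; rewrite inE ref_cubeE.
Qed.

Let nodal_poly : poly_on_cube (p i).-1 (fun x => nodal (F i x)).
Proof.
have [c cE] := lag_poly; exists c => x x1; rewrite -cE// nodalF//.
by move: x1; rewrite ref_cubeE.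
Qed.

Variable V : 'M[R]_d.
Hypothesis Vsym : V^T = V /\ \tr V = 0.

(** The discrete function with the value V at the Gauss point k of the element i
    and 0 at all others; V is taken symmetric and trace free so that the function
    lies in the discrete space. *)
Definition nodal_test_function (y : 'rV[R]_d) : 'M[R]_d := (nodal \_ (elt F i)) y *: V.

Local Notation q := nodal_test_function.

Let measurable_nodal : measurable_fun setT (nodal \_ (elt F i)).
Proof.
apply/(measurable_restrictT _ (measurable_elt hmesh i)).
exact: (measurable_elt_fun hmesh nodal_poly).
Qed.

Let q_L2_S0 : L2_S0 Omega q.
Proof.
have mT := measurable_elt hmesh i; have mO := measurable_domain hOmega.
split.
- apply: measurable_funTS; apply: measurable_fun_mx => l m.
  under eq_fun do rewrite mxE.
  by apply: measurable_funM => //; exact: measurable_nodal.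
- pose f y := nodal y * (frob V ^+ 2 * nodal y).
  have fi : (@leb R d).-integrable (elt F i) (EFin \o f).
    apply: (integrable_elt_mul hmesh (r := (p i).-1)) => //.
    exact: poly_on_cubeZ.
  have : (@leb R d).-integrable Omega (EFin \o (f \_ (elt F i))).
    apply: (@integrableS _ _ _ _ setT) => //.
    rewrite -restrict_EFin; apply/(integrable_restrict _ mT measurableT).
    by rewrite setTI.
  move=> /integrableP[_]; apply: le_lt_trans; rewrite le_eqVlt; apply/orP; left; apply/eqP.
  apply: eq_integral => y _; rewrite /nodal_test_function frobZ exprMn real_normK ?num_real//=.
  rewrite ger0_norm ?patchE; last first.
    by case: ifP => // _; rewrite /f mulrCA mulr_ge0 ?sqr_ge0// -expr2 sqr_ge0.
  by case: ifP => _; [rewrite /f; congr EFin; ring|rewrite expr0n mul0r].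
- apply: aeW => y _; rewrite /nodal_test_function.
  by rewrite linearZ /= Vsym.1 mxtraceZ Vsym.2 mulr0.
Qed.

Lemma nodal_test_repr : elt_repr F p q i q.
Proof.
split; last exact: aeW.
move=> l m; have [c cE] := @poly_on_cubeZ _ _ _ (V l m) _ nodal_poly.
exists c => x x1; rewrite -(cE x x1) mxE mulrC; congr (_ * _).
by rewrite patchE mem_set//; exists x.
Qed.

(** Distinct elements overlap in a null set only. *)
Lemma nodal_test_repr_other j : j != i -> elt_repr F p q j (fun=> 0).
Proof.
move=> ji; split.
  move=> l m; have [c cE] := @poly_on_cube0 R d (p j).-1.
  by exists c => x x1; rewrite -cE// mxE.
have h1 := ae_elt_in_interior hmesh j; have h2 := ae_elt_in_interior hmesh i.
apply: filterS2 h1 h2 => x xj xi' Tjx; rewrite /nodal_test_function patchE.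
case: ifPn => [/set_mem Tix|]; last by rewrite scale0r.
by rewrite (elt_interior_disjoint hmesh (xj Tjx) (xi' Tix)) eqxx in ji.
Qed.

Lemma nodal_test_Q_hp : Q_hp Omega F p q.
Proof.
split; first exact: q_L2_S0.
move=> j; have [->|ji] := eqVneq j i; first by exists q; exact: nodal_test_repr.
by exists (fun=> 0); exact: nodal_test_repr_other.
Qed.

Lemma nodal_test_node (l : {ffun 'I_d -> 'I_(p i)}) :
  elt_restr F p q i (F i (gauss_point (@xi (p i)) l)) = (l == k)%:R *: V.
Proof.
rewrite (elt_repr_nodes hmesh hxi hdet l (elt_reprP i nodal_test_Q_hp) nodal_test_repr).
have x1 := gauss_point_norm hxi l.
rewrite /nodal_test_function patchE mem_set; first by rewrite nodalF// lag_node.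
by rewrite eltE; exists (gauss_point (@xi (p i)) l).
Qed.

Lemma nodal_test_node_other j (l : {ffun 'I_d -> 'I_(p j)}) : j != i ->
  elt_restr F p q j (F j (gauss_point (@xi (p j)) l)) = 0.
Proof.
move=> ji.
exact: (elt_repr_nodes hmesh hxi hdet l (elt_reprP j nodal_test_Q_hp) (nodal_test_repr_other ji)).
Qed.

End nodal_test_function.

Theorem theorem4 (R : realType) (d : nat) (hd : d = 2%N \/ d = 3%N)
  (Omega : set 'rV[R]_d) (hOmega : bounded_lipschitz_domain Omega)
  (I : finType) (F : I -> 'rV[R]_d -> 'rV[R]_d) (p : I -> nat) (gamma : R)
  (hmesh : fe_mesh F p Omega gamma)
  (xi : forall n : nat, 'I_n -> R) (hxi : forall n, gauss_nodes (@xi n))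
  (sigma_y : R) (hsigma : 0 < sigma_y)
  (hdet : forall i, (2 <= p i)%N -> poly_on_cube 1 (det_grad (F i))) :
  Lambda_s Omega F p xi sigma_y = Lambda_w Omega F p xi sigma_y.
Proof.
apply/seteqP; split => mu [Qmu Hmu]; split => //.
  move=> q Qq; rewrite (L2_inner_quadrature hOmega hmesh hxi hdet Qmu Qq) (psi_hpE _ _ hxi).
  apply: ler_sum => i _; apply: ler_sum => k _.
  rewrite ler_wpM2l ?(ltW (elt_weight_gt0 hmesh hxi k))//.
  apply: le_trans (frob_cauchy_schwarz _ _) _.
  by rewrite ler_wpM2r ?sqrtr_ge0.
(* Test with the nodal function that takes at the Gauss point the value V of mu
   itself: both sums reduce to a single term, and the inequality becomes
   |V|^2 <= sigma_y |V|. *)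
move=> i k; set V := elt_restr F p mu i _.
have Vsym : V^T = V /\ \tr V = 0 by exact: (elt_restr_sym hOmega hmesh hxi hdet k Qmu).
pose q := nodal_test_function F xi k V.
have Qq : Q_hp Omega F p q by exact: (nodal_test_Q_hp hOmega hmesh).
have := Hmu q Qq; rewrite (L2_inner_quadrature hOmega hmesh hxi hdet Qmu Qq) (psi_hpE _ _ hxi).
rewrite (bigD1 i)//= [X in _ + X]big1 ?addr0; last first.
  move=> j ji; rewrite big1// => l _.
  by rewrite (nodal_test_node_other hOmega hmesh hxi hdet k Vsym)// frob_dot0r mulr0.
rewrite [leRHS](bigD1 i)//= [X in _ <= _ + X]big1 ?addr0; last first.
  move=> j ji; rewrite big1// => l _.
  rewrite (nodal_test_node_other hOmega hmesh hxi hdet k Vsym)//.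
  by rewrite -(scale0r V) frobZ normr0 mul0r !mulr0.
rewrite (bigD1 k)//= [X in _ + X]big1 ?addr0; last first.
  move=> l lk; rewrite (nodal_test_node hOmega hmesh hxi hdet k Vsym) (negbTE lk).
  by rewrite scale0r frob_dot0r mulr0.
rewrite [leRHS](bigD1 k)//= [X in _ <= _ + X]big1 ?addr0; last first.
  move=> l lk; rewrite (nodal_test_node hOmega hmesh hxi hdet k Vsym) (negbTE lk).
  by rewrite frobZ normr0 mul0r !mulr0.
rewrite (nodal_test_node hOmega hmesh hxi hdet k Vsym) eqxx scale1r -/V -sqr_frob.
rewrite ler_pM2l ?(elt_weight_gt0 hmesh hxi k)//.
have [->|V0] := eqVneq (frob V) 0; first by move=> _; exact: ltW.
by rewrite expr2 ler_pM2r// lt_def V0 sqrtr_ge0.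
Qed.
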